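(* Let $N^n$ be a real analytic manifold of dimension $n$, let $X^m$ be a connected $m$-dimensional real analytic DC-manifold ($m\le n$), and let $f:X^m\to N^n$ be a real analytic $m$-dimensional DC-map. If $f(X^m)$ is an analytically complete subset of $N^n$, then $f$ does not admit any analytic extension.
   Context: DC-manifolds. Let $m\ge 2$. The standard double-cone is $\mathcal C^m_2=\{(x_1,\dots,x_{m+1})\in\mathbf R^{m+1} : \sum_{j=1}^m x_j^2=x_{m+1}^2\}$, and $\pi^m:S^{m-1}\times\mathbf R\to\mathcal C^m_2$ is $\pi^m(\mathbf x,t)=(t\mathbf x,t)$, where $S^{m-1}\subset\mathbf R^m$ is the unit sphere. A topological DC-manifold of dimension $m$ is a second countable Hausdorff space $X$ each point of which has a neighborhood homeomorphic to an open subset of $\mathcal C^m_2$; a point corresponding to the origin of $\mathcal C_2^m$ is called a DC-point. If $\hat U\subset\mathcal C^m_2$ is open and $\varphi:\hat U\to O$ is a homeomorphism onto a connected open set $O\subset X$, put $U=(\pi^m)^{-1}(\hat U)$ and $\Phi=\varphi\circ\pi^m|_U:U\to O$; the pair $(U,\Phi)$ is an inverse DC-coordinate system. A real analytic DC-structure on $X$ is a collection $\{(U_\lambda,\Phi_\lambda)\}$ of inverse DC-coordinate systems such that the sets $O_\lambda=\Phi_\lambda(U_\lambda)$ cover $X$; whenever $O_\lambda\cap O_\mu\neq\varnothing$ there is a real analytic diffeomorphism $\Phi_{\mu\lambda}:\Phi_\lambda^{-1}(O_\mu)\to\Phi_\mu^{-1}(O_\lambda)$ with $\Phi_\mu\circ\Phi_{\mu\lambda}=\Phi_\lambda$;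 and the collection is maximal with this property. A real analytic DC-manifold is a topological DC-manifold with such a structure. Ordinary real analytic manifolds are regarded as DC-manifolds without DC-points. DC-maps. A map $f:X\to Y$ between real analytic DC-manifolds with structures $\{(U_\alpha,\Phi_\alpha)\}$ and $\{(V_\beta,\Psi_\beta)\}$ is a real analytic DC-map if for every pair $(\alpha,\beta)$ there is a real analytic map $F_{\alpha,\beta}:U_\alpha\cap\Phi_\alpha^{-1}(f^{-1}(\Psi_\beta(V_\beta)))\to V_\beta$ with $\Psi_\beta\circ F_{\alpha,\beta}=f\circ\Phi_\alpha$. (When the target is an ordinary real analytic manifold, this means that every $f\circ\Phi_\alpha$ is real analytic.) For connected $X^m$, a DC-map $f:X^m\to N^n$ is $m$-dimensional if there is an open dense subset of $X^m$ consisting of non-DC-points on which $f$ is an immersion. Analytic extension. For real analytic DC-maps $f_i:X_i^m\to N^n$ ($i=1,2$) on connected $m$-dimensional real analytic DC-manifolds, $f_2$ is an analytic extension of $f_1$ if there is a real analytic DC-map $\phi:X_1^m\to X_2^m$ with $f_1=f_2\circ\phi$ and $f_1(X_1^m)$ is a proper subset of $f_2(X_2^m)$. Analytic completeness. A non-empty subset $S\subset N^n$ is analytically complete if every real analytic map $\Gamma:[0,1]\to N^n$ with $\Gamma([0,\varepsilon))\subset S$ for some $\varepsilon\in(0,1)$ satisfies $\Gamma([0,1])\subset S$. *)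

(* Defs.v *)
From HB Require Import structures.
From mathcomp Require Import all_boot all_order all_algebra.
From mathcomp Require Import all_classical all_reals all_analysis.

Set Implicit Arguments.
Unset Strict Implicit.
Unset Printing Implicit Defensive.

Import Order.TTheory GRing.Theory Num.Theory.
Import numFieldNormedType.Exports.

Local Open Scope classical_set_scope.
Local Open Scope ring_scope.

(* Partial maps are represented by total functions together with a domain;
   the values outside the domain are irrelevant. *)

Definition homeomorphism_between (S T : topologicalType) (A : set S) (B : set T)
    (f : S -> T) : Prop :=
  [/\ f @` A = B, {within A, continuous f} &
      exists2 g : T -> S, {within B, continuous g}
                        & forall x, A x -> g (f x) = x].

Definition relatively_open (T : topologicalType) (C A : set T) : Prop :=
  exists2 W : set T, open W & A = C `&` W.

Definition maximal_with (T : Type) (P : set T -> Prop) (A : set T) : Prop :=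
  P A /\ forall B, P B -> A `<=` B -> B = A.

Section RealAnalytic.
Context {R : realType}.

Definition monomial p (h : 'rV[R]_p) (al : 'I_p -> nat) : R :=
  \prod_(i < p) h 0 i ^+ al i.

(* A multi-index of degree k has all its entries at most k, hence the finite
   type over which the sum ranges. *)
Definition homogeneous_part p (c : ('I_p -> nat) -> R) (k : nat)
    (h : 'rV[R]_p) : R :=
  \sum_(al : {ffun 'I_p -> 'I_k.+1} | (\sum_(i < p) al i == k)%N)
    c (fun i => al i) * monomial h (fun i => al i).

(* f is near a the sum of an absolutely convergent power series in x - a; the
   norm on row vectors is the sup norm, so the ball is a polydisc. *)
Definition analytic_fun_at p (f : 'rV[R]_p -> R) (a : 'rV[R]_p) : Prop :=
  exists c : ('I_p -> nat) -> R, exists2 r : R, 0 < r &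
    forall h : 'rV[R]_p, `|h| < r ->
      cvgn (series (fun k =>
        homogeneous_part (fun al => `|c al|) k (map_mx Num.norm h)))
      /\ (series (fun k => homogeneous_part c k h) @ \oo --> f (a + h)).

Definition analytic_at p q (f : 'rV[R]_p -> 'rV[R]_q) (a : 'rV[R]_p) : Prop :=
  forall j : 'I_q, analytic_fun_at (fun x => f x 0 j) a.

(* On a subset A of R^p (below: an open subset of the submanifold
   S^(m-1) x R of R^(m+1), or [0, 1]), a map is analytic when it extends
   locally to an analytic map of the ambient space. *)
Definition analytic_within p q (A : set 'rV[R]_p) (f : 'rV[R]_p -> 'rV[R]_q)
    (a : 'rV[R]_p) : Prop :=
  exists2 F : 'rV[R]_p -> 'rV[R]_q, analytic_at F a
    & \forall x \near a, A x -> f x = F x.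

Definition analytic_on p q (A : set 'rV[R]_p) (f : 'rV[R]_p -> 'rV[R]_q)
    : Prop :=
  forall a, A a -> analytic_within A f a.

Definition analytic_diffeo p (A B : set 'rV[R]_p) (G : 'rV[R]_p -> 'rV[R]_p)
    : Prop :=
  exists H : 'rV[R]_p -> 'rV[R]_p,
    [/\ analytic_on A G, analytic_on B H,
        (forall x, A x -> B (G x) /\ H (G x) = x)
      & (forall y, B y -> A (H y) /\ G (H y) = y)].

End RealAnalytic.

Section AnalyticManifold.
Context (R : realType).

Definition chart (N : Type) (n : nat) : Type := set N * (N -> 'rV[R]_n).

Definition is_chart (N : topologicalType) n (c : chart N n) : Prop :=
  [/\ open c.1, open (c.2 @` c.1) &
      homeomorphism_between c.1 (c.2 @` c.1) c.2].

Definition chart_compatible (N : Type) n (c d : chart N n) : Prop :=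
  exists2 G : 'rV[R]_n -> 'rV[R]_n, analytic_on (c.2 @` (c.1 `&` d.1)) G
    & forall x, (c.1 `&` d.1) x -> d.2 x = G (c.2 x).

Definition is_analytic_atlas (N : topologicalType) n (A : set (chart N n))
    : Prop :=
  [/\ (forall c, A c -> is_chart c),
      (forall x, exists2 c, A c & c.1 x)
    & (forall c d, A c -> A d -> chart_compatible c d)].

End AnalyticManifold.

Record analytic_manifold (R : realType) (n : nat) := AnalyticManifold {
  am_space :> topologicalType;
  am_atlas : set (chart R am_space n);
  am_second_countable : @second_countable am_space;
  am_hausdorff : hausdorff_space am_space;
  am_atlasP : maximal_with (@is_analytic_atlas R am_space n) am_atlas }.

Definition analytic_map_on (R : realType) p n (N : analytic_manifold R n)
    (A : set 'rV[R]_p) (g : 'rV[R]_p -> N) : Prop :=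
  {within A, continuous g} /\
  forall a (c : chart R N n), A a -> am_atlas c -> c.1 (g a) ->
    analytic_within A (c.2 \o g) a.

Section DoubleCone.
Context (R : realType) (m : nat).

Definition double_cone : set 'rV[R]_(m + 1) :=
  [set x | \sum_(j < m) lsubmx x 0 j ^+ 2 = rsubmx x 0 0 ^+ 2].

(* S^(m-1) x R inside R^m x R = R^(m+1). *)
Definition cylinder : set 'rV[R]_(m + 1) :=
  [set y | \sum_(j < m) lsubmx y 0 j ^+ 2 = 1].

Definition cylinder_tangent (y : 'rV[R]_(m + 1)) : set 'rV[R]_(m + 1) :=
  [set v | \sum_(j < m) lsubmx y 0 j * lsubmx v 0 j = 0].

Definition cone_proj (y : 'rV[R]_(m + 1)) : 'rV[R]_(m + 1) :=
  row_mx (rsubmx y 0 0 *: lsubmx y) (rsubmx y).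

Definition locally_conical (X : topologicalType) : Prop :=
  forall p : X, exists W : set X, nbhs p W /\
    exists Uhat phi, relatively_open double_cone Uhat /\
      homeomorphism_between Uhat W phi.

Definition is_dc_point (X : topologicalType) (p : X) : Prop :=
  exists W : set X, nbhs p W /\
    exists Uhat phi,
      [/\ relatively_open double_cone Uhat, Uhat 0,
          homeomorphism_between Uhat W phi & phi 0 = p].

Definition dc_coord (X : Type) : Type :=
  set 'rV[R]_(m + 1) * ('rV[R]_(m + 1) -> X).

Definition dc_image (X : Type) (c : dc_coord X) : set X := c.2 @` c.1.

Definition is_inverse_dc_coord (X : topologicalType) (c : dc_coord X) : Prop :=
  exists Uhat phi,
    [/\ relatively_open double_cone Uhat,
        homeomorphism_between Uhat (phi @` Uhat) phi,
        open (phi @` Uhat) /\ connected (phi @` Uhat),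
        c.1 = cylinder `&` cone_proj @^-1` Uhat
      & forall y, c.1 y -> c.2 y = phi (cone_proj y)].

Definition dc_compatible (X : Type) (c d : dc_coord X) : Prop :=
  dc_image c `&` dc_image d !=set0 ->
  exists2 G, analytic_diffeo (c.1 `&` c.2 @^-1` dc_image d)
                             (d.1 `&` d.2 @^-1` dc_image c) G
    & forall y, (c.1 `&` c.2 @^-1` dc_image d) y -> d.2 (G y) = c.2 y.

Definition is_dc_atlas (X : topologicalType) (A : set (dc_coord X)) : Prop :=
  [/\ (forall c, A c -> is_inverse_dc_coord c),
      (forall x, exists2 c, A c & dc_image c x)
    & (forall c d, A c -> A d -> dc_compatible c d)].

End DoubleCone.

Record dc_manifold (R : realType) (m : nat) := DCManifold {
  dc_space :> topologicalType;
  dc_atlas : set (dc_coord R m dc_space);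
  dc_second_countable : @second_countable dc_space;
  dc_hausdorff : hausdorff_space dc_space;
  dc_conical : @locally_conical R m dc_space;
  dc_atlasP : maximal_with (@is_dc_atlas R m dc_space) dc_atlas }.

Section DCMaps.
Context {R : realType}.

Definition dc_lift_domain m m' (X : dc_manifold R m) (Y : dc_manifold R m')
    (f : X -> Y) (c : dc_coord R m X) (d : dc_coord R m' Y)
    : set 'rV[R]_(m + 1) :=
  c.1 `&` c.2 @^-1` (f @^-1` dc_image d).

(* That the domain of the lift is open is part of its being a real analytic
   map; without this f could be discontinuous. *)
Definition is_dc_map m m' (X : dc_manifold R m) (Y : dc_manifold R m')
    (f : X -> Y) : Prop :=
  forall c d, dc_atlas c -> dc_atlas d ->
    relatively_open (@cylinder R m) (dc_lift_domain f c d) /\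
    exists2 F : 'rV[R]_(m + 1) -> 'rV[R]_(m' + 1),
      analytic_on (dc_lift_domain f c d) F
      & forall y, dc_lift_domain f c d y ->
          d.1 (F y) /\ d.2 (F y) = f (c.2 y).

Definition is_dc_map_to_manifold m n (X : dc_manifold R m)
    (N : analytic_manifold R n) (f : X -> N) : Prop :=
  forall c, dc_atlas c -> analytic_map_on c.1 (f \o c.2).

(* The differential of a map on the cylinder is the restriction to the tangent
   space of the differential of any local extension of the map. *)
Definition cylinder_immersion_at m n (N : analytic_manifold R n)
    (U : set 'rV[R]_(m + 1)) (g : 'rV[R]_(m + 1) -> N) (y : 'rV[R]_(m + 1))
    : Prop :=
  forall c : chart R N n, am_atlas c -> c.1 (g y) ->
    exists F : 'rV[R]_(m + 1) -> 'rV[R]_n,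
      [/\ analytic_at F y, (\forall x \near y, U x -> c.2 (g x) = F x)
        & forall v, cylinder_tangent y v -> 'd F y v = 0 -> v = 0].

Definition immersion_at m n (X : dc_manifold R m) (N : analytic_manifold R n)
    (f : X -> N) (p : X) : Prop :=
  forall (c : dc_coord R m X) y, dc_atlas c -> c.1 y -> c.2 y = p ->
    cylinder_immersion_at c.1 (f \o c.2) y.

Definition m_dimensional m n (X : dc_manifold R m) (N : analytic_manifold R n)
    (f : X -> N) : Prop :=
  exists D : set X,
    [/\ open D, dense D, (forall p, D p -> ~ @is_dc_point R m X p)
      & (forall p, D p -> immersion_at f p)].

Definition is_analytic_extension m n (N : analytic_manifold R n)
    (X1 X2 : dc_manifold R m) (f1 : X1 -> N) (f2 : X2 -> N) : Prop :=
  exists phi : X1 -> X2,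
    [/\ is_dc_map phi, (forall x, f1 x = f2 (phi x))
      & range f1 `<` range f2].

Definition admits_analytic_extension m n (N : analytic_manifold R n)
    (X : dc_manifold R m) (f : X -> N) : Prop :=
  exists (X2 : dc_manifold R m) (f2 : X2 -> N),
    [/\ connected [set: X2], is_dc_map_to_manifold f2
      & is_analytic_extension f f2].

Definition analytically_complete n (N : analytic_manifold R n) (S : set N)
    : Prop :=
  S !=set0 /\
  forall Gamma : R -> N,
    analytic_map_on [set s : 'rV[R]_1 | 0 <= s 0 0 <= 1]
                    (fun s => Gamma (s 0 0)) ->
    (exists2 eps : R, 0 < eps < 1 &
       forall t, 0 <= t < eps -> S (Gamma t)) ->
    forall t, 0 <= t <= 1 -> S (Gamma t).

End DCMaps.

(* Main.v *)
From HB Require Import structures.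
Require Import Defs.
From mathcomp Require Import all_boot all_order all_algebra.
From mathcomp Require Import all_classical all_reals all_analysis.
From mathcomp Require Import ring lra.
Import Order.TTheory GRing.Theory Num.Theory.
Import numFieldNormedType.Exports.
Local Open Scope classical_set_scope.
Local Open Scope ring_scope.

(** Suppose that f = f2 o phi is extended by f2 : X2 -> N and let S be the
    image of f.  At a point of X where f is an immersion, the lift of phi to the
    cylinders is an immersion between manifolds of equal dimension, hence open,
    so f2^-1(S) has nonempty interior.  Next, if an open part of a small
    coordinate neighbourhood in X2 is sent into S, the whole neighbourhood is:
    two points of S^(m-1) x R with non-antipodal sphere components are joined by
    a real analytic arc, whose image under f2 is an analytic curve of N starting
    in S, and analytic completeness keeps it in S.  So the interior of f2^-1(S)
    is open and closed, connectedness of X2 gives f2(X2) = S, and the extension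
    is not proper. *)

(** * Power series in one variable *)

(** Antipodal points shape the local argument. Off the vertex, a spherical cap times an interval of
    heights is enough, and no two of its points are antipodal. The fibre of the cone projection over
    the vertex, however, is a whole sphere, so a neighbourhood of a DC-point lifts to a band around
    height 0. Antipodal points of the band are reached in two stages through a third direction,
    which exists because m >= 2. The arcs are rational in the parameter, so their analyticity needs
    only sums, products and inverses of power series in one variable; functions of several variables
    are only composed with curves. The lift is an immersion by the chain rule, since f2 after the
    lift is f in coordinates. Its openness is obtained without inverting it: the distance to a
    prescribed target is minimised over a compact ball of the cylinder, and the minimum is shown to
    vanish. The resulting open set is carried to X2 near a point of nonzero height, because the cone
    projection collapses height 0. *)

Section PowerSeries.
Context {R : realType}.
Implicit Types (rho M : R) (g : R -> R).

(* [M] bounds the weighted l^1 norm of the coefficients; this norm is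
   submultiplicative, so the closure properties carry the bounds along. *)
Definition pseries_on (rho M : R) (g : R -> R) : Prop :=
  0 < rho /\ exists2 a : nat -> R,
    (forall N, \sum_(n < N) `|a n| * rho ^+ n <= M)
  & (forall h, `|h| <= rho -> series (fun n => a n * h ^+ n) @ \oo --> g h).

Lemma cvgn_sum_ord (K : nat) (u : 'I_K -> nat -> R) (l : 'I_K -> R) :
  (forall k, u k @ \oo --> l k) ->
  (fun n => \sum_(k < K) u k n) @ \oo --> \sum_(k < K) l k.
Proof. by move=> ul; apply: cvg_big => //; exact: add_continuous. Qed.

Lemma series_ord (u : nat -> R) : series u = (fun n => \sum_(k < n) u k).
Proof. by apply/funext => n; rewrite /series /= big_mkord. Qed.

Lemma absolute_cvgn (u v : nat -> R) : (forall n, `|u n| <= v n) ->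
  (exists B, forall N, \sum_(n < N) v n <= B) -> cvgn (series u).
Proof.
move=> uv [B vB]; have v0 n : 0 <= v n by apply: le_trans (uv n).
have vcv : cvgn (series v).
  apply: nondecreasing_is_cvgn.
    by apply/nondecreasing_seqP => n; rewrite /series /= big_nat_recr//= lerDl.
  by exists B => _ [n _ <-]; rewrite series_ord.
apply: normed_cvg.
exact: (series_le_cvg _ _ uv vcv).
Qed.

Lemma pseries_on_ext rho M M' g g' : pseries_on rho M g -> M <= M' ->
  (forall h, `|h| <= rho -> g h = g' h) -> pseries_on rho M' g'.
Proof.
move=> [rho0 [a aM ag]] MM' gg'; split=> //; exists a => [N|h hr];
  last by rewrite -gg'//; exact: ag.
exact: le_trans (aM N) MM'.
Qed.

Lemma pseries_on_ge0 rho M g : pseries_on rho M g -> 0 <= M.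
Proof. by move=> [_ [a /(_ 0%N)]]; rewrite big_ord0. Qed.

(* The coefficients of the sum are the sums of the coefficients; both the
   bound and the convergence follow from the tail bound [tail] below. *)
Lemma pseries_on_series rho (M : nat -> R) B (g : nat -> R -> R) G :
  (forall k, pseries_on rho (M k) (g k)) ->
  (forall K, \sum_(k < K) M k <= B) ->
  (forall h, `|h| <= rho -> series (fun k => g k h) @ \oo --> G h) ->
  pseries_on rho B G.
Proof.
move=> gM MB gG; have [rho0 _] := gM 0%N.
have /choice[a aP] : forall k, exists a : nat -> R,
    (forall N, \sum_(n < N) `|a n| * rho ^+ n <= M k) /\
    (forall h, `|h| <= rho -> series (fun n => a n * h ^+ n) @ \oo --> g k h).
  by move=> k; have [_ [a]] := gM k; exists a.
have M0 k : 0 <= M k by exact: pseries_on_ge0 (gM k).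
have rhon n : 0 < rho ^+ n by rewrite exprn_gt0.
have aM k n : `|a k n| <= M k / rho ^+ n.
  rewrite ler_pdivlMr//; apply: le_trans ((aP k).1 n.+1).
  rewrite big_ord_recr/= lerDr sumr_ge0// => i _.
  by rewrite mulr_ge0 ?(ltW (rhon _)).
have acv n : cvgn (series (fun k => a k n)).
  apply: (absolute_cvgn _ (fun k => M k / rho ^+ n)) => //.
  exists (B / rho ^+ n) => N; rewrite -mulr_suml ler_pdivrMr// mulfVK ?gt_eqF//.
have Mnd : {homo series M : n m / (n <= m)%N >-> n <= m}.
  by apply/nondecreasing_seqP => n; rewrite /series /= big_nat_recr//= lerDl.
have Mcv : cvgn (series M).
  apply: nondecreasing_is_cvgn => //.
  by exists B => _ [n _ <-]; rewrite series_ord.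
pose T K := limn (series M) - series M K.
have T0 : T @ \oo --> 0.
  by rewrite -[0](subrr (limn (series M))); apply: cvgB => //; exact: cvg_cst.
have tail K N :
    \sum_(n < N) `|limn (series (fun k => a k n)) - \sum_(k < K) a k n| * rho ^+ n
      <= T K.
  pose e K' (n : 'I_N) := 
    `|series (fun k => a k n) K' - \sum_(k < K) a k n| * rho ^+ n.
  apply: (@cvgr_to_le _ \oo _ _ (fun K' => \sum_(n < N) e K' n)).
    apply: cvgn_sum_ord => n; apply: cvgMr_tmp; apply: cvg_norm.
    by apply: cvgB; [exact: acv|exact: cvg_cst].
  exists K => // K' /= KK'.
  have eE n : e K' n <= \sum_(K <= k < K') `|a k n| * rho ^+ n.
    rewrite /e -mulr_suml ler_wpM2r ?(ltW (rhon _))//.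
    rewrite -(@big_mkord _ _ _ K xpredT (fun k => a k n)).
    rewrite /series/= (big_cat_nat (n := K))//=.
    by rewrite addrAC subrr add0r ler_norm_sum.
  apply: le_trans (ler_sum _ (fun n _ => eE n)) _; rewrite exchange_big/=.
  have : series M K' <= limn (series M) by exact: nondecreasing_cvgn_le.
  rewrite /T lerBrDl => /(le_trans _); apply.
  rewrite [series M K']/series/= (big_cat_nat (m := 0%N) (n := K) (p :=
    K'))//= lerD2l.
  by apply: ler_sum => k _; exact: (aP k).1.
split=> //; exists (fun n => limn (series (fun k => a k n))) => [N|h hr].
  (* The bound on the coefficients is the tail bound at [K = 0], where the subtracted partial sum is
     empty. *)
  have -> : \sum_(n < N) `|limn (series (fun k => a k n))| * rho ^+ n = 
    \sum_(n < N) `|limn (series (fun k => a k n)) - \sum_(k < 0) a k n| * rho ^+ n.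
    by apply: eq_bigr => n _; rewrite big_ord0 subr0.
  apply: (le_trans (tail 0%N N)); rewrite /T [series M 0%N]big_geq// subr0.
  by apply: (cvgr_to_le Mcv); apply: nearW => K; rewrite series_ord.
apply/cvgrPdist_lt => e e0; have e3 : 0 < e / 3 by rewrite divr_gt0.
(* [K] can be fixed before [N], because [T K] bounds the discarded part of every partial sum in [n]
   at once. *)
have [K [TK gK]] : exists K, T K < e / 3 /\ `|G h - series (fun k =>
  g k h) K| < e / 3.
  near (\oo : set_system nat) => K; exists K; split; near: K.
    by apply: (cvgr_lt _ T0).
  by move/cvgrPdist_lt : (gG h hr); apply.
have : (fun N => \sum_(k < K) series (fun n => a k n * h ^+ n) N) @ \oo -->
     \sum_(k < K) g k h by apply: cvgn_sum_ord => k; exact: (aP k).2.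
move/cvgrPdist_lt => /(_ _ e3); apply: filterS => N gN.
have bN : `|\sum_(k < K) series (fun n => a k n * h ^+ n) N -
   series (fun n => limn (series (fun k => a k n)) * h ^+ n) N| <= T K.
  apply: le_trans (tail K N).
  under eq_bigr do rewrite series_ord; rewrite series_ord exchange_big/=.
  rewrite -sumrB; apply: le_trans (ler_norm_sum _ _ _) _; apply: ler_sum => n _.
  rewrite -mulr_suml -mulrBl normrM distrC ler_wpM2l// normrX.
  by rewrite lerXn2r ?nnegrE ?(ltW rho0).
rewrite series_ord in gK.
have -> : e = e / 3 + e / 3 + e / 3 by field.
apply: (le_lt_trans _ (ltr_leD (ltrD gK gN) (le_trans bN (ltW TK)))).
apply: le_trans (lerD (ler_normD _ _) (lexx _)); apply: le_trans (ler_normD _ _).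
by rewrite !addrA !subrK.
Unshelve. all: by end_near. Qed.

Lemma pseries_on_cst rho (c : R) : 0 < rho -> pseries_on rho `|c| (fun=> c).
Proof.
move=> rho0; split=> //; exists (fun n => if n == 0%N then c else 0) => [[|N]|h _].
- by rewrite big_ord0.
- rewrite big_ord_recl/= expr0 mulr1 big1 ?addr0// => i _.
  by rewrite normr0 mul0r.
- apply: (cvg_near_cst); exists 1%N => // n /= n1.
  rewrite series_ord; case: n n1 => // n _.
  by rewrite big_ord_recl/= mulr1 big1 ?addr0// => i _; rewrite mul0r.
Qed.

Lemma pseries_onZ rho M g (c : R) : pseries_on rho M g ->
  pseries_on rho (`|c| * M) (fun h => c * g h).
Proof.
move=> [rho0 [a aM ag]]; split=> //; exists (fun n => c * a n) => [N|h hr].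
  under eq_bigr do rewrite normrM -mulrA.
  by rewrite -mulr_sumr ler_wpM2l.
have -> : series (fun n => c * a n * h ^+ n) =
    fun N => c * series (fun n => a n * h ^+ n) N.
  apply/funext => N; rewrite !series_ord mulr_sumr.
  by apply: eq_bigr => n _; rewrite mulrA.
by apply: cvgMl_tmp; exact: ag.
Qed.

Lemma pseries_onMX rho M g : pseries_on rho M g ->
  pseries_on rho (rho * M) (fun h => h * g h).
Proof.
move=> [rho0 [a aM ag]]; split=> //.
exists (fun n => if n is k.+1 then a k else 0) => [[|N]|h hr].
- by rewrite big_ord0 mulr_ge0 ?(ltW rho0)//; have := aM 0%N; rewrite big_ord0.
- rewrite big_ord_recl/= normr0 mul0r add0r.
  under eq_bigr do rewrite /bump leq0n add1n exprS mulrCA.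
  rewrite -mulr_sumr ler_wpM2l ?(ltW rho0)//; exact: aM.
- rewrite -cvg_shiftS.
  rewrite [X in X @ _ --> _](_ : _ = fun N => h * series (fun n =>
    a n * h ^+ n) N); last first.
    apply/funext => N; rewrite /= !series_ord big_ord_recl/= mul0r add0r mulr_sumr.
    by apply: eq_bigr => n _; rewrite /bump leq0n add1n exprS mulrCA.
  by apply: cvgMl_tmp; exact: ag.
Qed.

Lemma pseries_onMXn rho M g n : pseries_on rho M g ->
  pseries_on rho (rho ^+ n * M) (fun h => h ^+ n * g h).
Proof.
move=> gM; elim: n => [|n IH].
  by apply: (pseries_on_ext _ _ _ _ _ gM) => [|h _]; rewrite expr0 mul1r.
apply: (pseries_on_ext _ _ _ _ _ (pseries_onMX _ _ _ IH)) => [|h _].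
  by rewrite exprS mulrA.
by rewrite exprS mulrA.
Qed.

Lemma pseries_on_id rho : 0 < rho -> pseries_on rho rho id.
Proof.
move=> rho0; apply: (pseries_on_ext _ _ _ _ _ (pseries_onMX _ _ _
  (pseries_on_cst _ 1 rho0))) => [|h _]; by rewrite ?normr1 mulr1.
Qed.

Lemma pseries_onD rho M1 M2 g1 g2 : pseries_on rho M1 g1 ->
  pseries_on rho M2 g2 -> pseries_on rho (M1 + M2) (fun h => g1 h + g2 h).
Proof.
move=> [rho0 [a aM ag]] [_ [b bM bg]]; split=> //.
exists (fun n => a n + b n) => [N|h hr].
  apply: le_trans (lerD (aM N) (bM N)); rewrite -big_split/=.
  apply: ler_sum => n _; rewrite -mulrDl.
  by rewrite ler_wpM2r ?exprn_ge0 ?(ltW rho0)// ler_normD.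
have -> : series (fun n => (a n + b n) * h ^+ n) =
    series (fun n => a n * h ^+ n) \+ series (fun n => b n * h ^+ n).
  apply/funext => N; rewrite !series_ord /= -big_split/=.
  by apply: eq_bigr => n _; rewrite mulrDl.
by apply: cvgD; [exact: ag|exact: bg].
Qed.

(** No Cauchy product is formed: the product is the series over [k] of [a k * h ^+ k * g2 h], whose
    terms have norm at most [|a k| * rho ^+ k * M2], with sum at most [M1 * M2]. *)
Lemma pseries_onM rho M1 M2 g1 g2 : pseries_on rho M1 g1 ->
  pseries_on rho M2 g2 -> pseries_on rho (M1 * M2) (fun h => g1 h * g2 h).
Proof.
move=> [rho0 [a aM ag]] gM2.
apply: (pseries_on_series _ (fun k => `|a k| * (rho ^+ k * M2)) _
  (fun k h => a k * (h ^+ k * g2 h))) => [k|K|h hr].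
- exact/pseries_onZ/pseries_onMXn.
- under eq_bigr do rewrite mulrA.
  by rewrite -mulr_suml ler_wpM2r// (pseries_on_ge0 _ _ _ gM2).
- have -> : series (fun k => a k * (h ^+ k * g2 h)) =
      fun N => series (fun k => a k * h ^+ k) N * g2 h.
    apply/funext => N; rewrite !series_ord mulr_suml.
    by apply: eq_bigr => n _; rewrite mulrA.
  by apply: cvgMr_tmp; exact: ag.
Qed.

Lemma pseries_on_sum rho (I : Type) (r : seq I) (P : pred I) (M : I -> R)
    (g : I -> R -> R) :
  0 < rho -> (forall i, P i -> pseries_on rho (M i) (g i)) ->
  pseries_on rho (\sum_(i <- r | P i) M i) (fun h => \sum_(i <- r | P i) g i h).
Proof.
move=> rho0 gM; elim: r => [|i r IH].
  apply: (pseries_on_ext _ _ _ _ _ (pseries_on_cst _ 0 rho0)) => [|h _];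
    by rewrite big_nil ?normr0.
have -> : (fun h => \sum_(j <- i :: r | P j) g j h) =
    (fun h => let x := \sum_(j <- r | P j) g j h in if P i then g i h + x else x).
  by apply/funext => h; rewrite big_cons.
by rewrite big_cons; case: ifPn => // Pi; apply: pseries_onD => //; exact: gM.
Qed.

Lemma pseries_on_prod rho (I : Type) (r : seq I) (P : pred I) (M : I -> R)
    (g : I -> R -> R) :
  0 < rho -> (forall i, P i -> pseries_on rho (M i) (g i)) ->
  pseries_on rho (\prod_(i <- r | P i) M i) (fun h => \prod_(i <- r | P i) g i h).
Proof.
move=> rho0 gM; elim: r => [|i r IH].
  apply: (pseries_on_ext _ _ _ _ _ (pseries_on_cst _ 1 rho0)) => [|h _];
    by rewrite big_nil ?normr1.
have -> : (fun h => \prod_(j <- i :: r | P j) g j h) =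
    (fun h => let x := \prod_(j <- r | P j) g j h in if P i then g i h * x else x).
  by apply/funext => h; rewrite big_cons.
by rewrite big_cons; case: ifPn => // Pi; apply: pseries_onM => //; exact: gM.
Qed.

Lemma pseries_on_exp rho M g n : pseries_on rho M g ->
  pseries_on rho (M ^+ n) (fun h => g h ^+ n).
Proof.
move=> gM; have [rho0 _] := gM; elim: n => [|n IH].
  apply: (pseries_on_ext _ _ _ _ _ (pseries_on_cst _ 1 rho0)) => [|h _];
    by rewrite expr0 ?normr1.
by rewrite exprS; under eq_fun do rewrite exprS; exact: pseries_onM.
Qed.

Lemma pseries_on_le rho M g h : pseries_on rho M g -> `|h| <= rho -> `|g h| <= M.
Proof.
move=> [rho0 [a aM ag]] hr; have /cvg_norm := ag h hr => /cvgr_to_le; apply.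
apply: nearW => N; rewrite series_ord; apply: le_trans (aM N).
apply: le_trans (ler_norm_sum _ _ _) _; apply: ler_sum => n _.
by rewrite normrM normrX ler_wpM2l// lerXn2r ?nnegrE ?(ltW rho0).
Qed.

(** Since [g 0 = 0] there is no constant coefficient, and every other term gains at least one factor
    [rho' / rho]. This is what makes norms of increments small. *)
Lemma pseries_on_shrink rho rho' M g : pseries_on rho M g -> 0 < rho' ->
  rho' <= rho -> g 0 = 0 -> pseries_on rho' (M * (rho' / rho)) g.
Proof.
move=> [rho0 [a aM ag]] rho'0 rr g0; split=> //.
have r'r : 0 <= rho' / rho by rewrite divr_ge0 ?ltW.
have a0 : a 0%N = 0.
  have : series (fun n => a n * 0 ^+ n) @ \oo --> (0 : R).
    by rewrite -[X in _ --> X]g0; apply: ag; rewrite normr0 ltW.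
  move=> /cvg_lim <- //; apply/esym/cvg_lim => //.
  apply: cvg_near_cst; exists 1%N => // -[//|n] _.
  rewrite series_ord big_ord_recl/= expr0 mulr1 big1 ?addr0// => i _.
  by rewrite exprS mul0r mulr0.
exists a => [N|h hr]; last by apply: ag; rewrite (le_trans hr).
apply: le_trans (ler_wpM2r r'r (aM N)); rewrite mulr_suml.
apply: ler_sum => -[[|n] nN _]/=; first by rewrite a0 normr0 !mul0r.
rewrite -mulrA ler_wpM2l//.
rewrite [leRHS](_ : _ = rho ^+ n * rho'); last first.
  by rewrite exprSr -mulrA; congr *%R; rewrite mulrC divfK// gt_eqF.
by rewrite exprSr ler_wpM2r ?(ltW rho'0)// lerXn2r// ?nnegrE ltW.
Qed.

Lemma pseries_on_restrict rho rho' M g : pseries_on rho M g -> 0 < rho' ->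
  rho' <= rho -> pseries_on rho' M g.
Proof.
move=> [rho0 [a aM ag]] rho'0 rr; split=> //.
exists a => [N|h hr]; last by apply: ag; rewrite (le_trans hr).
apply: le_trans (aM N); apply: ler_sum => n _.
by rewrite ler_wpM2l// lerXn2r// ?nnegrE ltW.
Qed.

(** The Neumann series: by submultiplicativity the powers of [g] have norms at most [M ^+ k], and
    [M] also bounds [g] pointwise, so the sum is the inverse. *)
Lemma pseries_on_geometric rho M g : pseries_on rho M g -> M < 1 ->
  pseries_on rho (1 - M)^-1 (fun h => (1 - g h)^-1).
Proof.
move=> gM M1; have M0 := pseries_on_ge0 _ _ _ gM.
apply: (pseries_on_series _ (fun k => M ^+ k) _ (fun k h => g h ^+ k)) => [k|K|h hr].
- exact: pseries_on_exp.
- have -> : \sum_(k < K) M ^+ k = series (geometric 1 M) K.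
    by rewrite series_ord; apply: eq_bigr => k _ /=; rewrite mul1r.
  by rewrite geometric_seriesE ?lt_eqF//= mul1r -[leRHS]mul1r ler_wpM2r ?invr_ge0
    ?subr_ge0 ?(ltW M1)// gerBl exprn_ge0.
- have gh := pseries_on_le _ _ _ _ gM hr.
  have := @cvg_geometric_series R 1 (g h) (le_lt_trans gh M1).
  have -> : geometric 1 (g h) = (fun k => g h ^+ k).
    by apply/funext => k /=; rewrite mul1r.
  by rewrite mul1r.
Qed.

End PowerSeries.

(** * Composition and differentiability of analytic functions *)

Section RowNorm.
Context {R : realType}.

Lemma rV_norm_le p (x : 'rV[R]_p) (e : R) : 0 <= e ->
  (forall i, `|x 0 i| <= e) -> `|x| <= e.
Proof.
move=> e0 xe; rewrite [leLHS]/Num.norm/= mx_normrE; apply: bigmax_le => //= -[i j] _.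
by rewrite (ord1 i).
Qed.

Lemma rV_coord_le p (x : 'rV[R]_p) i : `|x 0 i| <= `|x|.
Proof.
rewrite [leRHS]/Num.norm/= mx_normrE.
exact: (@le_bigmax _ _ _ (0 : R) (fun ij => `|x ij.1 ij.2|) (0, i)).
Qed.

End RowNorm.

(** * Homogeneous parts of power series in several variables *)

Section Homogeneous.
Context {R : realType} {p : nat}.
Implicit Types (c : ('I_p -> nat) -> R) (h : 'rV[R]_p) (al : 'I_p -> nat).

(** The homogeneous part with coefficients [|c al|], evaluated at the vector with all entries 1.
    Thus absolute convergence at the corner of a polydisc controls the whole polydisc. *)
Definition coef_sum c (k : nat) : R :=
  \sum_(al : {ffun 'I_p -> 'I_k.+1} | (\sum_(i < p) al i == k)%N)
    `|c (fun i => al i)|.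

Lemma monomial_le h al e : `|h| <= e ->
  `|monomial h al| <= e ^+ (\sum_(i < p) al i)%N.
Proof.
move=> he; have e0 := le_trans (normr_ge0 h) he.
rewrite /monomial normr_prod -prodrXr; apply: ler_prod => i _.
rewrite normr_ge0 normrX /= lerXn2r ?nnegrE//.
by apply: le_trans he; exact: rV_coord_le.
Qed.

Lemma homogeneous_part_le c k h e : `|h| <= e ->
  `|homogeneous_part c k h| <= coef_sum c k * e ^+ k.
Proof.
move=> he; apply: le_trans (ler_norm_sum _ _ _) _; rewrite /coef_sum mulr_suml.
apply: ler_sum => al /eqP alk; rewrite normrM ler_wpM2l//.
by rewrite -[X in _ ^+ X]alk monomial_le.
Qed.

Lemma homogeneous_part_const c k (e : R) :
  homogeneous_part (fun al => `|c al|) k (const_mx e) = coef_sum c k * e ^+ k.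
Proof.
rewrite /homogeneous_part /coef_sum mulr_suml; apply: eq_bigr => al /eqP alk.
congr *%R; rewrite -[X in _ ^+ X]alk -prodrXr /monomial.
by apply: eq_bigr => i _; rewrite mxE.
Qed.

Lemma homogeneous_part0 c h : homogeneous_part c 0 h = homogeneous_part c 0 0.
Proof.
apply: eq_bigr => al _; congr *%R; apply: eq_bigr => i _.
by rewrite ord1 !expr0.
Qed.

Lemma homogeneous_part1 c : exists l : 'I_p -> R,
  forall h, homogeneous_part c 1 h = \sum_(i < p) l i * h 0 i.
Proof.
pose P (al : {ffun 'I_p -> 'I_2}) := (\sum_(i < p) al i == 1)%N.
(* For a multi-index of degree 1, [j] is the position of its only nonzero entry; [None] is a default
   for the other multi-indices. *)
have /choice[j jP] : forall al : {ffun 'I_p -> 'I_2}, exists j : option 'I_p, P al ->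
    forall h, monomial h (fun i => al i) = if j is Some i then h 0 i else 0.
  move=> al; case: (boolP (P al)) => [Pal|_]; last by exists None.
  have [j] : exists j, (al j != 0 :> nat)%N.
    apply: contrapT => /forallNP al0; move: Pal; rewrite /P big1// => i _.
    by apply/eqP/negPn/negP; exact: al0.
  move=> alj; exists (Some j) => _ h.
  have alj1 : al j = 1%N :> nat by case: (al j) alj => -[|[|]].
  rewrite /monomial (bigD1 j)//= alj1 expr1 big1 ?mulr1// => i ij.
  move: Pal; rewrite /P (bigD1 j)//= alj1 eqSS sum_nat_eq0.
  by move=> /forall_inP /(_ _ ij) /eqP ->; rewrite expr0.
exists (fun i => \sum_(al : {ffun 'I_p -> 'I_2} | P al) c (fun i =>
  al i) * (j al == Some i)%:R) => h.
transitivity (\sum_(i < p) \sum_(al : {ffun 'I_p -> 'I_2} | P al) c (fun i =>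
  al i) * (j al == Some i)%:R * h 0 i).
  rewrite exchange_big/=; apply: eq_bigr => al Pal; rewrite jP//.
  case jE: (j al) => [i|].
    rewrite (bigD1 i)//= eqxx mulr1 big1 ?addr0// => i' i'i.
    rewrite (_ : (Some i == Some i') = false) ?mulr0 ?mul0r//.
    by apply/eqP => -[] /eqP; rewrite eq_sym (negbTE i'i).
  by rewrite big1 ?mulr0// => i _; rewrite mulr0 mul0r.
by apply: eq_bigr => i _; rewrite mulr_suml.
Qed.

(** Halving the radius puts the corner of the closed polydisc inside the open domain of convergence;
    absolute convergence at that corner yields the bound [B]. *)
Lemma analytic_fun_expansion (f : 'rV[R]_p -> R) a : analytic_fun_at f a ->
  exists c, exists2 r, 0 < r &
    (exists B, forall N, \sum_(k < N) coef_sum c k * r ^+ k <= B) /\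
    forall h, `|h| <= r -> series (homogeneous_part c ^~ h) @ \oo --> f (a + h).
Proof.
move=> [c [r r0 cr]]; exists c, (r / 2); first by rewrite divr_gt0.
have r2 : r / 2 < r by rewrite ltr_pdivrMr// ltr_pMr// ltr1n.
split; last by move=> h hr; apply: (cr h _).2; exact: le_lt_trans r2.
have hr2 : `|const_mx (r / 2) : 'rV[R]_p| < r.
  apply: le_lt_trans r2; apply: rV_norm_le => [|i]; first by rewrite divr_ge0 ?ltW.
  by rewrite mxE gtr0_norm ?divr_gt0.
have := (cr _ hr2).1.
rewrite (_ : map_mx _ _ = const_mx (r / 2)); last first.
  by apply/matrixP => i j; rewrite !mxE gtr0_norm ?divr_gt0.
under eq_fun do rewrite homogeneous_part_const.
move=> Scv; exists (limn (series (fun k => coef_sum c k * (r / 2) ^+ k))) => N.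
rewrite [leLHS](_ : _ = series (fun k => coef_sum c k * (r / 2) ^+ k) N); last first.
  by rewrite series_ord.
apply: nondecreasing_cvgn_le => //.
apply/nondecreasing_seqP => n; rewrite /series /= big_nat_recr//= lerDl.
by rewrite mulr_ge0 ?exprn_ge0 ?divr_ge0 ?(ltW r0)// sumr_ge0.
Qed.

End Homogeneous.

(** * Composition of analytic functions with analytic curves *)

Section Composition.
Context {R : realType}.

Definition analytic1_at (g : R -> R) (a : R) : Prop :=
  exists rho M, pseries_on rho M (fun h => g (a + h)).

(** The increment has no constant term, so its norm is at most proportional to the radius. This
    gives the room needed to substitute a curve into another power series. *)
Lemma analytic1_increment g a e : analytic1_at g a -> 0 < e ->
  \forall rho \near 0^'+, pseries_on rho e (fun h => g (a + h) - g a).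
Proof.
move=> [rho [M gM]] e0; have [rho0 _] := gM.
have := pseries_onD _ _ _ _ _ gM (pseries_on_cst _ (- g a) rho0).
set M' := M + _ => gM'; have M'0 := pseries_on_ge0 _ _ _ gM'.
(* [M'] may vanish, so the radius is computed by dividing by [M' + 1]. *)
have M'1 : 0 < M' + 1 by rewrite ltr_wpDl.
near=> rho'.
have r'0 : 0 < rho' by [].
have r'r : rho' <= rho by near: rho'; exact: nbhs_right_le.
apply: (pseries_on_ext _ _ _ _ _ (pseries_on_shrink _ _ _ _ gM' r'0 r'r _)) => //.
- by rewrite addr0 subrr.
- rewrite mulrA ler_pdivrMr//.
  apply: (@le_trans _ _ ((M' + 1) * rho'));
    first by rewrite ler_wpM2r ?(ltW r'0)// lerDl.
  rewrite -ler_pdivlMl//; near: rho'; apply: nbhs_right_le.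
  by rewrite mulr_gt0 ?invr_gt0 ?mulr_gt0.
Unshelve. all: by end_near. Qed.

Lemma analytic1_increments (I : finType) (g : I -> R -> R) a e :
  (forall i, analytic1_at (g i) a) -> 0 < e ->
  exists rho, 0 < rho /\ forall i, pseries_on rho e (fun h => g i (a + h) - g i a).
Proof.
move=> ga e0; near (0 : R)^'+ => rho; exists rho; split=> //.
by near: rho; apply: filter_forall => i; exact: analytic1_increment.
Unshelve. all: by end_near. Qed.

(** On a radius where all coordinate increments of the curve have norm at most [r], the degree [k]
    part of [f] becomes a series of norm at most [coef_sum c k * r ^+ k]; these bounds have sums at
    most [B]. *)
Lemma analytic1_comp p (f : 'rV[R]_p -> R) (gam : R -> 'rV[R]_p) a :
  analytic_fun_at f (gam a) -> (forall i, analytic1_at (fun t => gam t 0 i) a) ->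
  analytic1_at (f \o gam) a.
Proof.
move=> /analytic_fun_expansion[c [r r0 [[B cB] cf]]] ga.
have [rho [rho0 gr]] := analytic1_increments _ _ _ _ ga r0.
exists rho, B.
apply: (pseries_on_series _ (fun k => coef_sum c k * r ^+ k) _
  (fun k h => homogeneous_part c k (gam (a + h) - gam a))) => //.
- move=> k; rewrite /homogeneous_part /coef_sum mulr_suml.
  apply: pseries_on_sum => // al /eqP alk.
  apply: pseries_onZ; rewrite -[X in _ ^+ X]alk -prodrXr.
  apply: pseries_on_prod => // i _; apply: pseries_on_exp.
  apply: (pseries_on_ext _ _ _ _ _ (gr i)) => // h _.
  by rewrite !mxE.
- move=> h hr; rewrite /=.
  have := cf (gam (a + h) - gam a); rewrite [gam a + _]addrC subrK; apply.
  apply: rV_norm_le => [|i]; first exact: ltW.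
  by rewrite !mxE; exact: pseries_on_le (gr i) hr.
Qed.

Lemma analytic1_cst (c a : R) : analytic1_at (fun=> c) a.
Proof. by exists 1, `|c|; exact: pseries_on_cst. Qed.

Lemma analytic1_id (a : R) : analytic1_at id a.
Proof.
exists 1, (`|a| + 1); apply: pseries_onD; first exact: pseries_on_cst.
exact: pseries_on_id.
Qed.

Lemma analytic1_common g1 g2 a : analytic1_at g1 a -> analytic1_at g2 a ->
  exists rho M1 M2, pseries_on rho M1 (fun h => g1 (a + h)) /\
    pseries_on rho M2 (fun h => g2 (a + h)).
Proof.
move=> [r1 [M1 H1]] [r2 [M2 H2]]; have [r10 _] := H1; have [r20 _] := H2.
exists (Num.min r1 r2), M1, M2; split.
  by apply: pseries_on_restrict H1 _ _; rewrite ?lt_min ?r10// ge_min lexx.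
by apply: pseries_on_restrict H2 _ _; rewrite ?lt_min ?r10// ge_min lexx orbT.
Qed.

Lemma analytic1D g1 g2 a : analytic1_at g1 a -> analytic1_at g2 a ->
  analytic1_at (fun t => g1 t + g2 t) a.
Proof.
move=> /analytic1_common /[apply] -[rho [M1 [M2 [H1 H2]]]].
by exists rho, (M1 + M2); exact: pseries_onD.
Qed.

Lemma analytic1M g1 g2 a : analytic1_at g1 a -> analytic1_at g2 a ->
  analytic1_at (fun t => g1 t * g2 t) a.
Proof.
move=> /analytic1_common /[apply] -[rho [M1 [M2 [H1 H2]]]].
by exists rho, (M1 * M2); exact: pseries_onM.
Qed.

(** Factor [g = g a * (1 - u)] with [u] the increment divided by [- g a]. Increments of norm at most
    [|g a| / 2] give [u] norm 1/2, so the geometric series applies, and they keep [g] away from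
    0. *)
Lemma analytic1V g a : analytic1_at g a -> g a != 0 ->
  analytic1_at (fun t => (g t)^-1) a.
Proof.
move=> ga ga0.
have ng : 0 < `|g a| by rewrite normr_gt0.
have [|rho [rho0 /(_ tt) gr]] := analytic1_increments unit (fun=> g) a (`|g a| /
  2) (fun=> ga).
  by rewrite divr_gt0.
have H := pseries_onZ _ _ _ (- (g a)^-1) gr.
have e : `|- (g a)^-1| * (`|g a| / 2) = 2^-1 by rewrite normrN normfV mulrA mulVf
  ?mul1r// gt_eqF.
rewrite e in H.
have H2 := pseries_on_geometric _ _ _ H (ltac:(by rewrite invf_lt1 ?ltr1n)).
have H3 := pseries_onZ _ _ _ (g a)^-1 H2.
eexists; eexists; apply: (pseries_on_ext _ _ _ _ _ H3 (lexx _)) => h hr.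
have d0 : g (a + h) != 0.
  apply/negP => /eqP E; have := pseries_on_le _ _ _ _ gr hr.
  rewrite E sub0r normrN ler_pdivlMr// ger_pMr// leNgt => /negP; apply.
  by rewrite ltr1n.
rewrite -invfM; congr GRing.inv; field.
exact: ga0.
Qed.

Lemma analytic1_analytic_at p (gam : R -> 'rV[R]_p) (s : 'rV[R]_1) :
  (forall i, analytic1_at (fun t => gam t 0 i) (s 0 0)) ->
  analytic_at (fun s => gam (s 0 0)) s.
Proof.
move=> ga i; have [rho [M [rho0 [a aM ag]]]] := ga i.
exists (fun al => a (al ord0)), rho => // h hr.
have hom (b : nat -> R) k (h' : 'rV[R]_1) :
    homogeneous_part (fun al => b (al ord0)) k h' = b k * h' 0 0 ^+ k.
  (* In one variable the only multi-index of degree [k] is the one whose entry is the largest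
     element of ['I_k.+1]. *)
  rewrite /homogeneous_part (big_pred1 [ffun=> ord_max])/=.
    by rewrite /monomial big_ord1 ffunE.
  move=> al; rewrite big_ord1 /=; apply/eqP/eqP => [alk|->]; last by rewrite ffunE.
  by apply/ffunP => j; rewrite (ord1 j) ffunE; exact: val_inj.
have hr' : `|h 0 0| <= rho by rewrite (le_trans (rV_coord_le _ _ _))// ltW.
split; last first.
  under eq_fun do rewrite hom.
  by rewrite mxE; exact: ag.
under eq_fun do rewrite (hom (fun n => `|a n|)) mxE.
apply: (absolute_cvgn _ (fun n => `|a n| * rho ^+ n)); last by exists M.
by move=> n; rewrite normrM normrX !normr_id ler_wpM2l// lerXn2r ?nnegrE ?(ltW rho0).
Qed.

End Composition.

(** * First-order expansions and derivatives along curves *)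

Section Differentiability.
Context {R : realType}.

Lemma rV_cvg (T : Type) (F : set_system T) {FF : Filter F} q (f : T -> 'rV[R]_q)
  (l : 'rV[R]_q) :
  (forall i, (fun t => f t 0 i) @ F --> (l 0 i : R)) -> f @ F --> l.
Proof.
move=> fl; apply/cvgrPdist_le => e e0.
have : \forall t \near F, forall i, `|l 0 i - f t 0 i| <= e.
  apply: filter_forall => i; exact: ((cvgrPdist_le _ _).1 (fl i)).
apply: filterS => t tl; apply: rV_norm_le => [|i]; first exact: ltW.
by rewrite !mxE.
Qed.

Lemma mulmxr_continuous p q (J : 'M[R]_(p, q)) :
  continuous (fun h : 'rV[R]_p => h *m J).
Proof.
move=> h; apply: (@rV_cvg _ (nbhs h) (nbhs_filter h)) => i.
rewrite mxE; under eq_fun do rewrite mxE.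
apply: cvg_big => //; first exact: add_continuous.
move=> j _; apply: cvgMr_tmp; exact: coord_continuous.
Qed.

(** From two terms on, the constant and linear parts cancel out of the partial sums. Every remaining
    part has degree at least 2, hence is at most [|h| ^+ 2 / r ^+ 2] times its bound on the polydisc
    of radius [r]. *)
Lemma analytic_fun_linearization p (f : 'rV[R]_p -> R) a : analytic_fun_at f a ->
  exists l : 'I_p -> R, exists C, exists2 r, 0 < r & forall h, `|h| <= r ->
    `|f (a + h) - f a - \sum_(i < p) h 0 i * l i| <= C * `|h| ^+ 2.
Proof.
move=> /analytic_fun_expansion[c [r r0 [[B cB] cf]]].
have [l lP] := homogeneous_part1 c.
exists l, (B / r ^+ 2), r => // h hr.
have key h' : `|h'| <= r ->
    `|f (a + h') - homogeneous_part c 0 h' - homogeneous_part c 1 h'| <= B / r ^+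
      2 * `|h'| ^+ 2.
  move=> h'r.
  have : (fun n => `|series (homogeneous_part c ^~ h') n
      - homogeneous_part c 0 h' - homogeneous_part c 1 h'|) @ \oo -->
    `|f (a + h') - homogeneous_part c 0 h' - homogeneous_part c 1 h'|.
    apply: cvg_norm; apply: cvgB; last exact: cvg_cst.
    by apply: cvgB; [exact: cf|exact: cvg_cst].
  move/cvgr_to_le; apply; exists 2%N => // -[|[|n]]// _.
  have cancel x y z : x + (y + z) - x - y = z :> R by ring.
  rewrite series_ord big_ord_recl big_ord_recl/= cancel.
  apply: le_trans (ler_norm_sum _ _ _) _.
  apply: (@le_trans _ _ (\sum_(k < n) coef_sum c k.+2 * r ^+ k.+2 / r ^+ 2 *
    `|h'| ^+ 2)).
    apply: ler_sum => k _.
    apply: le_trans (homogeneous_part_le c k.+2 h' _ (lexx _)) _.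
    have c0 : 0 <= coef_sum c k.+2 by apply: sumr_ge0.
    have E (x : R) : x ^+ k.+2 = x ^+ k * x ^+ 2 by rewrite -exprD addn2.
    rewrite !E [in leRHS]mulrA mulfK ?expf_neq0 ?gt_eqF// -mulrA ler_wpM2l//.
    by rewrite ler_wpM2r ?exprn_ge0// lerXn2r ?nnegrE ?(ltW r0).
  rewrite -!mulr_suml ler_wpM2r ?exprn_ge0// ler_wpM2r ?invr_ge0 ?exprn_ge0 ?(ltW
    r0)//.
  apply: le_trans (cB n.+2); rewrite 2!big_ord_recl/= addrA lerDr addr_ge0//.
    by rewrite mulr_ge0 ?exprn_ge0 ?(ltW r0)// sumr_ge0.
  by rewrite mulr_ge0 ?exprn_ge0 ?(ltW r0)// sumr_ge0.
(* At increment 0 the right-hand side of [key] vanishes, which identifies the constant term. *)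
have fa : f a = homogeneous_part c 0 0.
  have := key 0; rewrite normr0 ltW// => /(_ isT).
  rewrite expr0n/= mulr0 normr_le0 addr0 lP big1 ?subr0 ?subr_eq0 => [/eqP//|i _].
  by rewrite mxE mulr0.
have := key h hr; rewrite homogeneous_part0 -fa lP.
by under [in X in X -> _]eq_bigr do rewrite mulrC.
Qed.

Lemma analytic_differentiable p q (F : 'rV[R]_p -> 'rV[R]_q) a :
  analytic_at F a -> differentiable F a.
Proof.
move=> Fa.
have /choice[l lP] : forall j : 'I_q, exists l : 'I_p -> R, 
  exists C, exists2 r, 0 < r & forall h, `|h| <= r ->
    `|F (a + h) 0 j - F a 0 j - \sum_(i < p) h 0 i * l i| <= C * `|h| ^+ 2.
  by move=> j; exact: analytic_fun_linearization (Fa j).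
pose J : 'M[R]_(p, q) := \matrix_(i, j) l j i.
pose V : normedModType R := 'rV[R]_p; pose W : normedModType R := 'rV[R]_q.
pose L : {linear V -> W} := mulmxr J.
have Fo : (F \o shift a : V -> W) = cst (F a) + L +o_ (0 : V) id.
  apply/eqaddoP => e e0 /=.
  have : \forall h \near (0 : 'rV[R]_p), forall j,
     `|F (a + h) 0 j - F a 0 j - \sum_(i < p) h 0 i * l j i| <= e * `|h|.
    apply: (@filter_forall _ _ _ (nbhs (0 : 'rV[R]_p)) (nbhs_filter _)) => j;
      have [C [r r0 Cr]] := lP j.
    (* [C] is not known to be positive, and the radius is obtained by dividing by it. *)
    have C1 : 0 < Num.max C 1 by rewrite lt_max ltr01 orbT.
    have eC : 0 < (Num.max C 1)^-1 * e by rewrite mulr_gt0 ?invr_gt0.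
    apply: filterS2 (@nbhs0_le _ 'rV[R]_p _ r0) (@nbhs0_le _ 'rV[R]_p _ eC) =>
      h hr he.
    apply: le_trans (Cr h hr) _; rewrite expr2 mulrA ler_wpM2r//.
    apply: (@le_trans _ _ (Num.max C 1 * `|h|));
      first by rewrite ler_wpM2r// le_max lexx.
    by rewrite -ler_pdivlMl.
  apply: filterS => h hP; apply: rV_norm_le => [|j]; first by rewrite mulr_ge0// ltW.
  rewrite !fctE/= !mxE (eq_bigr (fun i => h 0 i * l j i)) => [|i _];
    last by rewrite mxE.
  by have := hP j; rewrite [a + h]addrC opprD addrA.
apply/diff_locallyP; rewrite (@diff_unique R V W F L a _ Fo);
  last exact: mulmxr_continuous.
by split => //; exact: mulmxr_continuous.
Qed.

Lemma differentiable_eps p q (F : 'rV[R]_p -> 'rV[R]_q) a e :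
  differentiable F a -> 0 < e ->
  \forall h \near 0, `|F (a + h) - F a - 'd F a h| <= e * `|h|.
Proof.
move=> /diff_locallyP[_] /eqaddoP /(_ e) /[apply]; apply: filterS => h.
by rewrite !fctE /= (addrC h) opprD addrA.
Qed.

Lemma is_derive_comp_curve p q (F : 'rV[R]_p -> 'rV[R]_q) (gam : R -> 'rV[R]_p)
  (t : R) (v : 'rV[R]_p) :
  differentiable F (gam t) -> is_derive t 1 gam v ->
  is_derive t 1 (F \o gam) ('d F (gam t) v).
Proof.
move=> dF [dgam gamv].
have dg : differentiable gam t by apply/derivable1_diffP.
have dFg : differentiable (F \o gam) t by exact: differentiable_comp.
split; first exact/derivable1_diffP.
rewrite deriveE// diff_comp//=.
by rewrite (_ : 'd gam t 1 = v)// -gamv deriveE.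
Qed.

Lemma is_derive_coord q (gam : R -> 'rV[R]_q) (t : R) (v : 'rV[R]_q) i :
  is_derive t 1 gam v -> is_derive t 1 (fun s => gam s 0 i : R) (v 0 i).
Proof.
move=> [dgam <-]; split; first by move/derivable_mxP : dgam.
by rewrite derive_mx// mxE.
Qed.

Lemma is_derive_row q (gam : R -> 'rV[R]_q) (t : R) (v : 'rV[R]_q) :
  (forall i, is_derive t 1 (fun s => gam s 0 i : R) (v 0 i)) -> is_derive t 1 gam v.
Proof.
move=> gv; have dg : derivable gam t 1.
  by apply/derivable_mxP => i j; rewrite (ord1 i); have [] := gv j.
split=> //; rewrite derive_mx//; apply/rowP => i; rewrite mxE.
by have [_] := gv i.
Qed.

End Differentiability.

(** * Analytic arcs on the cylinder *)

Section Dot.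
Context {R : realType} {p : nat}.
Implicit Types u v w : 'rV[R]_p.

(** The norm of row vectors is the sup norm, so Euclidean geometry is expressed through this
    product. *)
Definition dot u v : R := \sum_(j < p) u 0 j * v 0 j.

Lemma dotC u v : dot u v = dot v u.
Proof. by apply: eq_bigr => j _; rewrite mulrC. Qed.

Lemma dotDl u v w : dot (u + v) w = dot u w + dot v w.
Proof. by rewrite -big_split; apply: eq_bigr => j _; rewrite mxE mulrDl. Qed.

Lemma dotZl a u v : dot (a *: u) v = a * dot u v.
Proof. by rewrite mulr_sumr; apply: eq_bigr => j _; rewrite mxE mulrA. Qed.

Lemma dotDr u v w : dot w (u + v) = dot w u + dot w v.
Proof. by rewrite dotC dotDl !(dotC w). Qed.

Lemma dotZr a u v : dot v (a *: u) = a * dot v u.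
Proof. by rewrite dotC dotZl dotC. Qed.

Lemma dotNl u v : dot (- u) v = - dot u v.
Proof. by rewrite -scaleN1r dotZl mulN1r. Qed.

Lemma dotNr u v : dot v (- u) = - dot v u.
Proof. by rewrite dotC dotNl dotC. Qed.

Lemma dot_ge0 u : 0 <= dot u u.
Proof. by apply: sumr_ge0 => j _; rewrite -expr2 sqr_ge0. Qed.

Lemma dot_eq0 u : dot u u = 0 -> u = 0.
Proof.
move=> /eqP; rewrite psumr_eq0 => [/allP uj|j _]; last by rewrite -expr2 sqr_ge0.
by apply/rowP => j; rewrite mxE; have := uj j (mem_index_enum _);
  rewrite mulf_eq0 orbb => /eqP.
Qed.

Lemma dot_sqr u : dot u u = \sum_(j < p) u 0 j ^+ 2.
Proof. by apply: eq_bigr => j _; rewrite expr2. Qed.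

Lemma dot_coord_le u j : u 0 j ^+ 2 <= dot u u.
Proof. by rewrite dot_sqr (bigD1 j)//= lerDl sumr_ge0// => i _; rewrite sqr_ge0. Qed.

(* The reflection of [u] in the line spanned by [u + t v]: a rational
   parametrisation, from [u] at 0 to [v] at 1, of an arc of great circle. *)
Definition arc u v (t : R) : 'rV[R]_p :=
  (1 + 2 * dot u v * t + t ^+ 2)^-1 *:
    ((1 - t ^+ 2) *: u + (2 * t * (1 + dot u v * t)) *: v).

Lemma arc0 u v : arc u v 0 = u.
Proof.
rewrite /arc expr0n/= !(mulr0,mul0r,addr0,subr0) invr1 !scale1r.
by rewrite scale0r addr0.
Qed.

Section Unit.
Context {u v : 'rV[R]_p} (u1 : dot u u = 1) (v1 : dot v v = 1) (uv : v != - u).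

Lemma dot_unit_gtN1 : -1 < dot u v.
Proof.
have : dot (u + v) (u + v) != 0.
  by apply/negP => /eqP /dot_eq0 /eqP; rewrite addrC addr_eq0 (negbTE uv).
have := dot_ge0 (u + v); rewrite dotDl !dotDr u1 v1 (dotC v u) => + /eqP; lra.
Qed.

Lemma dot_unit_le1 : dot u v <= 1.
Proof.
have := dot_ge0 (u - v).
by rewrite dotDl !dotDr !dotNl !dotNr u1 v1 (dotC v u); lra.
Qed.

Lemma arc_denom_gt0 t : 0 <= t <= 1 -> 0 < 1 + 2 * dot u v * t + t ^+ 2.
Proof.
move=> /andP[t0 t1]; have k := dot_unit_gtN1.
rewrite [ltRHS](_ : _ = (1 - t) ^+ 2 + 2 * (t * (1 + dot u v))); last by ring.
move: t0; rewrite le_eqVlt => /predU1P[<-|t0].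
  by rewrite subr0 expr1n mul0r mulr0 addr0.
by rewrite ltr_wpDl ?sqr_ge0// mulr_gt0// mulr_gt0//; lra.
Qed.

Lemma arc1 : arc u v 1 = v.
Proof.
have := dot_unit_gtN1 => k.
rewrite /arc !expr1n subrr scale0r add0r scalerA !mulr1.
rewrite [X in X *: _](_ : _ = 1) ?scale1r//; field; lra.
Qed.

Lemma arc_unit t : 0 <= t <= 1 -> dot (arc u v t) (arc u v t) = 1.
Proof.
move=> /arc_denom_gt0; rewrite /arc; set D := 1 + _ + _ => D0.
rewrite dotZl dotZr !(dotDl,dotDr,dotZl,dotZr) u1 v1 (dotC v u) /D.
field; rewrite -/D; lra.
Qed.

(* A point of the arc is a nonnegative combination of the end points whose
   coefficients add up to at least 1. *)
Lemma arc_cap u0 c t : 0 <= c -> c < dot u u0 -> c < dot v u0 -> 0 <= t <= 1 ->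
  c < dot (arc u v t) u0.
Proof.
move=> c0 uc vc t01; have D0 := arc_denom_gt0 t t01; have /andP[t0 t1] := t01.
have k := dot_unit_gtN1; have k1 := dot_unit_le1.
rewrite /arc dotZl mulrC ltr_pdivlMr// dotDl !dotZl.
set kk := dot u v in D0 k k1 *.
have A0 : 0 <= 1 - t ^+ 2 by rewrite subr_ge0 expr_le1.
have kt : 0 <= 1 + kk * t by nra.
have B0 : 0 <= 2 * t * (1 + kk * t) by rewrite !mulr_ge0.
have AB : 1 + 2 * kk * t + t ^+ 2 <= (1 - t ^+ 2) + 2 * t * (1 + kk * t).
  rewrite -subr_ge0 [leRHS](_ : _ = 2 * (t * (1 - t) * (1 - kk))); last by ring.
  by rewrite !mulr_ge0 ?subr_ge0.
have AB0 : 0 < (1 - t ^+ 2) + 2 * t * (1 + kk * t) by exact: lt_le_trans AB.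
apply: (@le_lt_trans _ _ (c * ((1 - t ^+ 2) + 2 * t * (1 + kk * t)))).
  by rewrite ler_wpM2l.
move: A0 B0 AB0; set A := 1 - _; set B := 2 * t * _ => A0 B0 AB0.
(* Strictness comes from the term in [u] when [A > 0]; when [A = 0], that is at [t = 1], it comes
   from the term in [v]. *)
rewrite mulrDr; have [A00|A00] := eqVneq A 0.
  rewrite A00 mulr0 mul0r !add0r mulrC ltr_pM2l//; first by move: AB0;
    rewrite A00 add0r.
rewrite ltr_leD//; first by rewrite mulrC ltr_pM2l// lt_neqAle eq_sym A00.
by rewrite mulrC ler_wpM2l// ltW.
Qed.

Lemma arc_analytic t i : 0 <= t <= 1 -> analytic1_at (fun t => arc u v t 0 i) t.
Proof.
move=> /arc_denom_gt0 D0.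
have -> : (fun t => arc u v t 0 i) = (fun t => (1 + 2 * dot u v * t + t * t)^-1 *
   ((1 + -1 * (t * t)) * u 0 i + 2 * t * (1 + dot u v * t) * v 0 i)).
  by apply/funext => s; rewrite !mxE !expr2 mulN1r.
repeat (apply: analytic1M || apply: analytic1D || apply: analytic1_cst || apply:
  analytic1V || exact: analytic1_id).
by rewrite -expr2 gt_eqF.
Qed.

End Unit.
End Dot.

Section CylinderArc.
Context {R : realType} {m : nat}.
Implicit Types y z : 'rV[R]_(m + 1).

Lemma cylinder_dot y : cylinder y <-> dot (lsubmx y) (lsubmx y) = 1.
Proof. by rewrite dot_sqr. Qed.

Lemma analytic1_continuous (g : R -> R) (a : R) : analytic1_at g a ->
  {for a, continuous g}.
Proof.
move=> ga; apply/cvgrPdist_le => e e0.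
have [|rho [rho0 /(_ tt) gr]] := analytic1_increments unit (fun=> g) a e (fun=>
  ga) => //.
near=> x; rewrite distrC.
have := pseries_on_le _ _ _ (x - a) gr; rewrite /= (addrC a) subrK; apply.
by rewrite distrC; near: x; exact: cvgr_dist_le.
Unshelve. all: by end_near. Qed.

Definition cyl_arc y z (t : R) : 'rV[R]_(m + 1) :=
  row_mx (arc (lsubmx y) (lsubmx z) t) ((1 - t) *: rsubmx y + t *: rsubmx z).

Lemma cyl_arc0 y z : cyl_arc y z 0 = y.
Proof. by rewrite /cyl_arc arc0 subr0 scale1r scale0r addr0 hsubmxK. Qed.

Context {y z : 'rV[R]_(m + 1)} (ycyl : cylinder y) (zcyl : cylinder z)
  (yz : lsubmx z != - lsubmx y).

Let y1 : dot (lsubmx y) (lsubmx y) = 1. Proof. exact/cylinder_dot. Qed.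
Let z1 : dot (lsubmx z) (lsubmx z) = 1. Proof. exact/cylinder_dot. Qed.

Lemma cyl_arc1 : cyl_arc y z 1 = z.
Proof. by rewrite /cyl_arc arc1// subrr scale0r scale1r add0r hsubmxK. Qed.

Lemma cyl_arc_cylinder t : 0 <= t <= 1 -> cylinder (cyl_arc y z t).
Proof. by move=> t01; apply/cylinder_dot; rewrite row_mxKl arc_unit. Qed.

Lemma cyl_arc_analytic t i : 0 <= t <= 1 ->
  analytic1_at (fun t => cyl_arc y z t 0 i) t.
Proof.
move=> t01; have [j ->|j ->] := split_ordP i.
  have -> : (fun t => cyl_arc y z t 0 (lshift 1 j)) =
      (fun t => arc (lsubmx y) (lsubmx z) t 0 j).
    by apply/funext => s; rewrite row_mxEl.
  exact: arc_analytic.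
have -> : (fun t => cyl_arc y z t 0 (rshift m j)) =
    (fun t => (1 + -1 * t) * rsubmx y 0 j + t * rsubmx z 0 j).
  by apply/funext => s; rewrite row_mxEr !mxE mulN1r.
by repeat (apply: analytic1M || apply: analytic1D || apply: analytic1_cst ||
  exact: analytic1_id).
Qed.

Lemma cyl_arc_continuous t : 0 <= t <= 1 -> {for t, continuous (cyl_arc y z)}.
Proof.
move=> t01; apply: rV_cvg => i.
exact: (analytic1_continuous _ _ (cyl_arc_analytic _ i t01)).
Qed.

End CylinderArc.

(** * Analytic completeness along arcs of the cylinder *)

Section Propagation.
Context {R : realType} {m n : nat} {N : analytic_manifold R n}.

Lemma analytic_map_comp_curve (V : set 'rV[R]_(m + 1)) (g : 'rV[R]_(m + 1) -> N)
    (gam : R -> 'rV[R]_(m + 1)) :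
  analytic_map_on V g ->
  (forall t i, 0 <= t <= 1 -> analytic1_at (fun t => gam t 0 i) t) ->
  (forall t, 0 <= t <= 1 -> V (gam t)) ->
  analytic_map_on [set s : 'rV[R]_1 | 0 <= s 0 0 <= 1] (fun s => g (gam (s 0 0))).
Proof.
move=> [gcont gan] gaman gamV.
have gamc (s : 'rV[R]_1) : 0 <= s 0 0 <= 1 ->
    (fun s : 'rV[R]_1 => gam (s 0 0)) @ s --> gam (s 0 0).
  move=> s01; apply: (@rV_cvg _ _ _ (nbhs_filter s)) => i.
  apply: (@continuous_comp _ _ _ (fun s : 'rV[R]_1 => s 0 0) (fun t => gam t 0 i)).
    exact: coord_continuous.
  exact: (analytic1_continuous _ _ (gaman _ i s01)).
split.
  apply/subspace_continuousP => s s01 /=.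
  move/subspace_continuousP : gcont => /(_ _ (gamV _ s01)).
  apply: (cvg_comp (fun s : 'rV[R]_1 => gam (s 0 0)) g) => P.
  rewrite /within/= => /(gamc _ s01) gP.
  apply: (@filterS _ (nbhs s) (nbhs_filter s) _ _ _ gP) => x /= {}gP x01.
  by apply: gP; exact: gamV.
move=> s c s01 cN cs; have [F Fan gF] := gan _ _ (gamV _ s01) cN cs.
exists (fun s => F (gam (s 0 0))).
  apply: (analytic1_analytic_at _ (fun t => F (gam t))) => j.
  exact: (analytic1_comp _ _ _ _ (Fan j) (fun i => gaman _ i s01)).
apply: (@filterS _ (nbhs s) (nbhs_filter s) _ _ _ (gamc _ s01 _ gF)) => x /= xF x01.
by apply: xF; exact: gamV.
Qed.

(** The starting set [P] has to be relatively open: an initial segment of the arc, not just its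
    origin, must be sent into [S] before completeness can carry the end point there. *)
Lemma analytically_complete_arc (V P : set 'rV[R]_(m + 1))
    (g : 'rV[R]_(m + 1) -> N) (S : set N) (y z : 'rV[R]_(m + 1)) :
  analytically_complete S -> analytic_map_on V g ->
  relatively_open (@cylinder R m) P -> P y -> (forall x, P x -> S (g x)) ->
  cylinder z -> lsubmx z != - lsubmx y ->
  (forall t, 0 <= t <= 1 -> V (cyl_arc y z t)) -> S (g z).
Proof.
move=> [_ Scomplete] gan [W Wo PE] Py PS zcyl yz yzV.
have [ycyl Wy] : cylinder y /\ W y by move: Py; rewrite PE.
have := Scomplete (fun t => g (cyl_arc y z t)).
rewrite -[in X in _ -> S X](cyl_arc1 ycyl zcyl yz); apply; last by rewrite ler01 lexx.
  apply: (analytic_map_comp_curve V) => // t i t01; exact: cyl_arc_analytic.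
have t0 : 0 <= (0 : R) <= 1 by rewrite lexx ler01.
have : \forall t \near (0 : R), W (cyl_arc y z t).
  apply: (cyl_arc_continuous ycyl zcyl yz _ t0).
  by rewrite cyl_arc0; exact: open_nbhs_nbhs.
(* Analytic completeness asks for an initial segment of length less than 1, whence the bound
   [1 / 2]. *)
move=> /nbhs_ballP[e /= e0 eW]; exists (Num.min e (1 / 2)).
  by rewrite lt_min e0/= divr_gt0//= gt_min orbC ltr_pdivrMr// mul1r ltr1n.
move=> t /andP[t00]; rewrite lt_min => /andP[te t12]; apply: PS; rewrite PE; split.
  apply: cyl_arc_cylinder => //; rewrite t00 (le_trans (ltW t12))//.
  by rewrite ler_pdivrMr// mul1r ler1n.
by apply: eW; rewrite /ball/= sub0r normrN ger0_norm.
Qed.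
End Propagation.

(** * Local propagation in a DC-manifold *)

Section Topology.

Lemma within_continuous_open (S T : topologicalType) (A : set S) (f : S -> T)
    (O : set T) :
  {within A, continuous f} -> open O -> relatively_open A (A `&` f @^-1` O).
Proof.
move=> /continuousP /[apply] /open_subspaceP[W Wo WE].
by exists W => //; rewrite setIC -WE setIC.
Qed.

Lemma homeomorphism_image_open (S T : topologicalType) (A W : set S) (f : S -> T) :
  homeomorphism_between A (f @` A) f -> open (f @` A) -> open W ->
  open (f @` (A `&` W)).
Proof.
move=> [_ _ [g gc gK]] fAo Wo.
have [W' W'o W'E] := within_continuous_open _ _ _ _ _ gc Wo.
suff -> : f @` (A `&` W) = f @` A `&` g @^-1` W by rewrite W'E; exact: openI.
apply/seteqP; split => [_ [x [Ax Wx] <-]|_ [[x Ax <-]]] /=.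
  by split; [exists x|rewrite /= gK].
by rewrite gK// => Wx; exists x.
Qed.

(** The interior of [A] is closed: if [x] is in its closure, the neighbourhood [U] given at [x]
    meets it in a nonempty open set contained in [A], so all of [U] lies in [A]. *)
Lemma connected_propagation (T : topologicalType) (A : set T) :
  connected [set: T] -> (A° !=set0) ->
  (forall x, exists2 O, open O /\ O x &
     forall O', open O' -> O' !=set0 -> O' `<=` O -> O' `<=` A -> O `<=` A) ->
  A = [set: T].
Proof.
move=> Tc A0 Aloc; suff E : A° = [set: T].
  by apply/seteqP; split=> // x _; apply: interior_subset; rewrite E.
apply: Tc => //; first by exists A°; [exact: open_interior|rewrite setTI].
exists A°; last by rewrite setTI.
rewrite closure_id; apply/seteqP; split; first exact: subset_closure.
move=> x clx; have [U [Uo Ux] UP] := Aloc x.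
have [z [Az Uz]] := clx U (open_nbhs_nbhs (conj Uo Ux)).
apply: (@filterS _ (nbhs x) _ U); last exact: open_nbhs_nbhs.
apply: (UP (A° `&` U)).
- by apply: openI => //; exact: open_interior.
- by exists z.
- exact: subIsetr.
- by move=> y [/interior_subset].
Qed.

End Topology.

(** * Caps on the cylinder and their images on the cone *)

Section Cylinder.
Context {R : realType} {m : nat}.
Implicit Types y z q : 'rV[R]_(m + 1).

Lemma lsubmx_coord_continuous j : continuous (fun y => lsubmx y 0 j).
Proof.
have -> : (fun y => lsubmx y 0 j) = (fun y => y 0 (lshift 1 j)).
  by apply/funext => y; rewrite mxE.
exact: coord_continuous.
Qed.

Lemma rsubmx_coord_continuous : continuous (fun y => rsubmx y 0 0).
Proof.
have -> : (fun y => rsubmx y 0 0) = (fun y => y 0 (rshift m 0)).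
  by apply/funext => y; rewrite mxE.
exact: coord_continuous.
Qed.

Lemma dot_lsubmx_continuous (u : 'rV[R]_m) : continuous (fun y => dot (lsubmx y) u).
Proof.
move=> y; apply: (cvg_big _ (nbhs_filter y)); first exact: add_continuous.
by move=> j _; apply: cvgMr_tmp; exact: lsubmx_coord_continuous.
Qed.

Lemma cone_proj_continuous : continuous (@cone_proj R m).
Proof.
move=> y; apply: (@rV_cvg _ _ _ (nbhs_filter y)) => i.
have [j ->|j ->] := split_ordP i.
  have E x : cone_proj x 0 (lshift 1 j) = rsubmx x 0 0 * lsubmx x 0 j.
    by rewrite row_mxEl mxE.
  rewrite E; under eq_fun do rewrite E.
  by apply: cvgM; [exact: rsubmx_coord_continuous|exact: lsubmx_coord_continuous].
rewrite (ord1 j); have E x : cone_proj x 0 (rshift m 0) = rsubmx x 0 0.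
  by rewrite row_mxEr.
by rewrite E; under eq_fun do rewrite E; exact: rsubmx_coord_continuous.
Qed.

Lemma lsubmx_cone_proj y : lsubmx (cone_proj y) = rsubmx y 0 0 *: lsubmx y.
Proof. by rewrite row_mxKl. Qed.

Lemma rsubmx_cone_proj y : rsubmx (cone_proj y) = rsubmx y.
Proof. by rewrite row_mxKr. Qed.

Lemma double_cone_dot q :
  double_cone q <-> dot (lsubmx q) (lsubmx q) = rsubmx q 0 0 ^+ 2.
Proof. by rewrite dot_sqr. Qed.

Lemma cone_proj_cone y : cylinder y -> double_cone (cone_proj y).
Proof.
move=> /cylinder_dot y1; apply/double_cone_dot.
by rewrite lsubmx_cone_proj rsubmx_cone_proj dotZl dotZr y1 mulr1 expr2.
Qed.

Lemma cone_proj_onto q : double_cone q -> rsubmx q 0 0 != 0 ->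
  exists2 z, cylinder z & cone_proj z = q.
Proof.
move=> /double_cone_dot qc q0.
exists (row_mx ((rsubmx q 0 0)^-1 *: lsubmx q) (rsubmx q)).
  apply/cylinder_dot; rewrite row_mxKl dotZl dotZr qc; field; exact: q0.
by rewrite /cone_proj row_mxKl row_mxKr scalerA mulfV// scale1r hsubmxK.
Qed.

Lemma cone_proj0 y : rsubmx y 0 0 = 0 -> cone_proj y = 0.
Proof.
move=> y0; have r0 : rsubmx y = 0 by apply/rowP => i; rewrite (ord1 i) y0 mxE.
by rewrite /cone_proj y0 scale0r r0 row_mx0.
Qed.

Lemma double_cone0 q : double_cone q -> rsubmx q 0 0 = 0 -> q = 0.
Proof.
move=> /double_cone_dot qc q0; rewrite -[q]hsubmxK.
have -> : rsubmx q = 0 by apply/rowP => i; rewrite (ord1 i) q0 mxE.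
rewrite (dot_eq0 (lsubmx q)) ?row_mx0//.
by rewrite qc q0 expr0n.
Qed.

(** These neighbourhoods are used instead of norm balls because they are stable under the arcs: a
    spherical cap inside a hemisphere under great circle arcs, an interval of heights under affine
    paths. *)
Definition cap (eta : R) y : set 'rV[R]_(m + 1) :=
  [set z | [/\ cylinder z, 1 - eta < dot (lsubmx z) (lsubmx y) &
               (rsubmx z 0 0 - rsubmx y 0 0) ^+ 2 < eta]].

(* The image of [cap] on the cone, with denominators cleared; the strict first
   inequality excludes the vertex. *)
Definition cone_cap (eta : R) y : set 'rV[R]_(m + 1) :=
  [set q | (1 - eta) * rsubmx q 0 0 ^+ 2 <
              rsubmx q 0 0 * dot (lsubmx q) (lsubmx y) /\
           (rsubmx q 0 0 - rsubmx y 0 0) ^+ 2 < eta].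

Lemma cap_self eta y : 0 < eta -> cylinder y -> cap eta y y.
Proof.
move=> e0 yc; split => //; last by rewrite subrr expr0n.
by have /cylinder_dot -> := yc; rewrite ltrBlDr ltrDl.
Qed.

Lemma cap_nbhs y (P : set 'rV[R]_(m + 1)) : cylinder y -> nbhs y P ->
  exists2 eta, 0 < eta <= 1 & cap eta y `<=` P.
Proof.
move=> yc /nbhs_ballP[e /= e0 eP].
have e28 : 0 < e ^+ 2 / 8 by rewrite divr_gt0 ?exprn_gt0.
(* Two unit vectors with dot product above [1 - eta] are at squared distance below [2 * eta]; with
   [eta] at most [e ^+ 2 / 8] this is at most [(e / 2) ^+ 2]. *)
exists (Num.min 1 (e ^+ 2 / 8)); first by rewrite lt_min ltr01 e28/= ge_min lexx.
move=> z [zc zy sz]; apply: eP; rewrite -ball_normE /ball_/=.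
have e2e : e / 2 < e by rewrite ltr_pdivrMr// ltr_pMr// ltr1n.
apply: le_lt_trans e2e; rewrite distrC.
have sq (x : R) : x ^+ 2 <= (e / 2) ^+ 2 -> `|x| <= e / 2.
  by move=> xe; rewrite -(ler_pXn2r (n := 2))// ?nnegrE ?divr_ge0 ?(ltW e0)//
    real_normK ?num_real.
apply: rV_norm_le => [|i]; first by rewrite divr_ge0 ?ltW.
apply: sq; have E : (e / 2) ^+ 2 = e ^+ 2 / 4 by field.
rewrite E; have [j ->|j ->] := split_ordP i.
  have -> : (z - y) 0 (lshift 1 j) = (lsubmx z - lsubmx y) 0 j by rewrite !mxE.
  apply: le_trans (dot_coord_le _ _) _.
  have /cylinder_dot z1 := zc; have /cylinder_dot y1 := yc.
  rewrite dotDl !dotDr !dotNl !dotNr z1 y1 (dotC (lsubmx y)).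
  have : 1 - (e ^+ 2 / 8) < dot (lsubmx z) (lsubmx y).
    by apply: le_lt_trans zy; rewrite lerD2l lerN2 ge_min lexx orbT.
  lra.
have -> : (z - y) 0 (rshift m j) = rsubmx z 0 0 - rsubmx y 0 0 by rewrite (ord1
  j) !mxE.
apply: ltW; apply: lt_le_trans sz _; rewrite ge_min; apply/orP; right; lra.
Qed.

(** The condition [eta <= 1] places the cap in the open hemisphere around [y], which excludes
    antipodal pairs and gives [arc_cap] its nonnegative threshold. The heights are handled by
    convexity of the square. *)
Lemma cap_arc eta y y1 y2 : eta <= 1 -> cylinder y -> cap eta y y1 -> cap eta y y2 ->
  lsubmx y2 != - lsubmx y1 /\
  forall t, 0 <= t <= 1 -> cap eta y (cyl_arc y1 y2 t).
Proof.
move=> e1 yc [c1 d1 s1] [c2 d2 s2].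
have e0 : 0 <= 1 - eta by rewrite subr_ge0.
have ne : lsubmx y2 != - lsubmx y1.
  by apply/negP => /eqP E; move: d2; rewrite E dotNl; lra.
split=> // t t01; split.
- exact: cyl_arc_cylinder.
- by rewrite row_mxKl; apply: arc_cap => //; exact/cylinder_dot.
- rewrite row_mxKr !mxE.
  move: s1 s2; rewrite !mxE => s1 s2; have /andP[t0 t1] := t01.
  move: s1 s2; set a := y1 _ _; set b := y2 _ _; set c := y _ _ => s1 s2.
  apply: (@le_lt_trans _ _ ((1 - t) * (a - c) ^+ 2 + t * (b - c) ^+ 2)).
    rewrite -subr_ge0 [leRHS](_ : _ = t * (1 - t) * (a - b) ^+ 2); last by ring.
    by rewrite mulr_ge0 ?sqr_ge0// mulr_ge0// subr_ge0.
  rewrite [ltRHS](_ : eta = (1 - t) * eta + t * eta); last by ring.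
  have [->|t'] := eqVneq t 1; first by rewrite subrr !mul0r !add0r !mul1r.
  rewrite ltr_leD// ?ltr_pM2l// ?subr_gt0 ?lt_neqAle ?t'//.
  by rewrite ler_wpM2l// ltW.
Qed.

Lemma cone_cap_open eta y : open (cone_cap eta y).
Proof.
pose r q : R := rsubmx q 0 0; pose d q := dot (lsubmx q) (lsubmx y).
have rc : continuous r := rsubmx_coord_continuous.
have dc : continuous d by exact: dot_lsubmx_continuous.
have -> : cone_cap eta y =
  ((r \* d) \+ (cst (eta - 1) \* (r \* r))) @^-1` [set x | 0 < x] `&`
  ((r \- cst (r y)) \* (r \- cst (r y))) @^-1` [set x | x < eta].
  apply/seteqP; rewrite /cone_cap /r /d; split=> q /=; rewrite -!expr2 => -[q1 q2];
    split=> //; lra.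
apply: openI; apply: open_comp; try exact: open_gt; try exact: open_lt; move=> q _.
  apply: continuousD; apply: continuousM; [exact: rc|exact: dc|exact:
    cst_continuous|].
  by apply: continuousM; exact: rc.
by apply: continuousM; apply: continuousB;
  [exact: rc|exact: cst_continuous|exact: rc|exact: cst_continuous].
Qed.

Lemma cap_cone_cap eta y z : rsubmx z 0 0 != 0 -> cap eta y z ->
  cone_cap eta y (cone_proj z).
Proof.
move=> z0 [zc zy sz]; split; rewrite rsubmx_cone_proj//.
rewrite lsubmx_cone_proj dotZl [ltRHS]mulrA -expr2 mulrC ltr_pM2l//.
by rewrite exprn_even_gt0.
Qed.

Lemma cone_cap_onto eta y q : double_cone q -> cone_cap eta y q ->
  exists2 z, cap eta y z & cone_proj z = q.
Proof.
move=> qc [q1 q2]; have q0 : rsubmx q 0 0 != 0.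
  by apply/negP => /eqP q0; move: q1; rewrite q0 expr0n/= mulr0 mul0r ltxx.
have [z zc zq] := cone_proj_onto q qc q0; exists z => //.
move: q1 q2; rewrite -zq rsubmx_cone_proj lsubmx_cone_proj => q1 q2; split=> //.
move: q1; rewrite dotZl [ltRHS]mulrA -expr2 mulrC ltr_pM2l// exprn_even_gt0//=.
by move: q0; rewrite -zq rsubmx_cone_proj.
Qed.

End Cylinder.

(** * Propagation inside one inverse DC-coordinate system *)

Section DCCoordinates.
Context {R : realType} {m : nat}.

Lemma dc_coord_preimage_open (X : topologicalType) (d : dc_coord R m X) (U : set X) :
  is_inverse_dc_coord d -> open U ->
  relatively_open (@cylinder R m) (d.1 `&` d.2 @^-1` U).
Proof.
move=> [Uhat [phi [[W0 W0o UE] [_ phic _] _ dE dphi]]] Uo.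
have [W1 W1o W1E] := within_continuous_open _ _ _ _ _ phic Uo.
exists (@cone_proj R m @^-1` (W0 `&` W1)).
  apply: open_comp; last exact: openI.
  by move=> y _; exact: cone_proj_continuous.
have W1P q : Uhat q -> W1 q <-> U (phi q).
  move=> Uq; split=> [Wq|Uphi].
    by have : (Uhat `&` W1) q by []; rewrite -W1E => -[].
  by have : (Uhat `&` phi @^-1` U) q by []; rewrite W1E => -[].
apply/seteqP; split=> y /=.
  move=> [dy Uy]; have := dy; rewrite dE => -[yc Uhy]; split=> //; split.
    by move: Uhy; rewrite UE => -[].
  by apply/W1P => //; rewrite -dphi.
move=> [yc [W0y W1y]]; have Uhy : Uhat (cone_proj y).
  by rewrite UE; split=> //; exact: cone_proj_cone.
have dy : d.1 y by rewrite dE; split.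
by split=> //; rewrite dphi//; apply/W1P.
Qed.

(** If the first basis vector is [u] or [- u], the second one is neither. On the two-point sphere of
    dimension 0 there may be no such vector. *)
Lemma sphere_third_point (u : 'rV[R]_m) : (2 <= m)%N ->
  exists2 e : 'rV[R]_m, dot e e = 1 & e != u /\ e != - u.
Proof.
move=> m2; pose i0 : 'I_m := Ordinal (ltnW m2); pose i1 : 'I_m := Ordinal m2.
have unit i : dot (delta_mx 0 i : 'rV[R]_m) (delta_mx 0 i) = 1.
  rewrite /dot (bigD1 i)//= !mxE !eqxx mulr1 big1 ?addr0// => j ji.
  by rewrite !mxE eqxx (negbTE ji) mulr0.
have d10 : (delta_mx 0 i1 : 'rV[R]_m) 0 i0 = 0 by rewrite mxE.
have d00 : (delta_mx 0 i0 : 'rV[R]_m) 0 i0 = 1 by rewrite mxE !eqxx.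
have [E|] := boolP ((delta_mx 0 i0 != u) && (delta_mx 0 i0 != - u)).
  by exists (delta_mx 0 i0) => //; apply/andP.
rewrite negb_and !negbK => /orP u0.
have u00 : u 0 i0 = 1 \/ u 0 i0 = -1.
  case: u0 => /eqP E; [left|right].
    by rewrite -E.
  by have := congr1 (fun w : 'rV[R]_m => w 0 i0) E; rewrite d00 mxE; lra.
exists (delta_mx 0 i1) => //; split; apply/eqP => /(congr1 (fun w : 'rV[R]_m =>
  w 0 i0));
  rewrite d10 ?mxE; case: u00 => ->; lra.
Qed.

Context {n : nat} {N : analytic_manifold R n} (X : dc_manifold R m) (f : X -> N)
  (S : set N).

(** The local hypothesis of [connected_propagation], for the preimage of [S]. *)
Definition fills_locally (U : set X) : Prop :=
  forall U', open U' -> U' !=set0 -> U' `<=` U -> U' `<=` f @^-1` S ->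
    U `<=` f @^-1` S.

(** The height of [y0] decides the shape of the neighbourhood. If it is nonzero, the image of
    [cone_cap] is taken, and one arc inside a cap joins any two points. If it is zero, the
    neighbourhood has to contain the image of a whole band, and antipodal pairs need a second
    arc. *)
Lemma dc_local_propagation : (2 <= m)%N -> is_dc_map_to_manifold f ->
  analytically_complete S ->
  forall x, exists2 U : set X, open U /\ U x & fills_locally U.
Proof.
move=> m2 fan Sc x; have [[dcoord cover _] _] := dc_atlasP X.
have [d dX [y0 dy0 dy0x]] := cover x.
have gan := fan d dX.
have dinv := dcoord d dX.
have [Uhat [phi [[W0 W0o UE] phih [phio _] dE dphi]]] := dinv.
have y0c : cylinder y0 by move: dy0; rewrite dE => -[].
have xphi : x = phi (cone_proj y0) by rewrite -dy0x dphi.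
have W0y0 : W0 (cone_proj y0) by move: dy0; rewrite dE UE => -[_ []].
have dW0 z : cylinder z -> W0 (cone_proj z) -> d.1 z.
  by move=> zc zW; rewrite dE; split=> //=; rewrite UE; split=> //;
    exact: cone_proj_cone.
have arcS (U' : set X) y z : open U' -> U' `<=` f @^-1` S -> d.1 y -> U' (d.2 y) ->
    cylinder z -> lsubmx z != - lsubmx y ->
    (forall t, 0 <= t <= 1 -> d.1 (cyl_arc y z t)) -> S (f (d.2 z)).
  move=> U'o U'S dy U'y zc yz arcd.
  apply: (analytically_complete_arc _ _ _ _ y z Sc gan
    (dc_coord_preimage_open _ _ _ dinv U'o)) => //.
  by move=> w [_ /U'S].
have [s0|s0] := eqVneq (rsubmx y0 0 0) 0; last first.
  have [eta /andP[e0 e1] capW0] : exists2 eta, 0 < eta <= 1 &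
      cap eta y0 `<=` @cone_proj R m @^-1` W0.
    apply: cap_nbhs => //; apply: cone_proj_continuous.
    exact: open_nbhs_nbhs.
  have capd z : cap eta y0 z -> d.1 z.
    by move=> zcap; apply: dW0; [case: zcap|exact: capW0].
  exists (phi @` (Uhat `&` cone_cap eta y0)).
    split; first by apply: homeomorphism_image_open => //; exact: cone_cap_open.
    exists (cone_proj y0) => //; split; first by move: dy0; rewrite dE => -[].
    by apply: cap_cone_cap => //; exact: cap_self.
  have capE p : (phi @` (Uhat `&` cone_cap eta y0)) p -> exists2 z, cap eta y0 z
    & d.2 z = p.
    move=> [q [Uq capq] <-].
    have qc : double_cone q by move: Uq; rewrite UE => -[].
    have [z zcap zq] := cone_cap_onto _ _ _ qc capq.
    by exists z => //; rewrite dphi ?zq//; exact: capd.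
  move=> U' U'o [p' U'p'] U'U U'S p /capE[z zcap <-].
  have [z' z'cap z'p'] := capE _ (U'U _ U'p').
  have [zz' arcd] := cap_arc _ _ _ _ e1 y0c z'cap zcap.
  apply: (arcS U' z') => //.
  - exact: capd.
  - by rewrite z'p'.
  - by case: zcap.
  - by move=> t t01; apply: capd; exact: arcd.
have py0 : cone_proj y0 = 0 by exact: cone_proj0.
have [e /= e0 eW0] : exists2 e : R, 0 < e & forall q, `|q| < e -> W0 q.
  have /nbhs_ballP[e /= e0 eW] : nbhs (0 : 'rV[R]_(m + 1)) W0.
    by rewrite -py0; exact: open_nbhs_nbhs.
  by exists e => // q qe; apply: eW; rewrite -ball_normE /ball_/= sub0r normrN.
pose B : set 'rV[R]_(m + 1) := [set q | `|rsubmx q 0 0| < e].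
have Bo : open B.
  rewrite [B](_ : _ = (fun q => `|rsubmx q 0 0|) @^-1` [set s | s < e])//.
  apply: open_comp; last exact: open_lt.
  by move=> q _; apply: (@cvg_norm _ _ _ _ (nbhs_filter q));
    exact: rsubmx_coord_continuous.
(* The sphere component is a unit vector, so the sup norm of [cone_proj z] is at most the absolute
   value of the height: the whole band lands in the ball of radius [e]. *)
have Bd z : cylinder z -> B z -> d.1 z.
  move=> zc Bz; apply: dW0 => //; apply: eW0; apply: le_lt_trans Bz.
  apply: rV_norm_le => // i; have [j ->|j ->] := split_ordP i.
    rewrite row_mxEl mxE normrM ler_piMr//.
    have := dot_coord_le (lsubmx z) j; have /cylinder_dot -> := zc.
    by rewrite -[X in _ <= X -> _](expr1n _ 2) -real_normK ?num_real//
      ler_pXn2r// nnegrE.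
  by rewrite row_mxEr (ord1 j).
exists (phi @` (Uhat `&` B)).
  split; first exact: homeomorphism_image_open.
  exists (cone_proj y0) => //; split; first by move: dy0; rewrite dE => -[].
  by rewrite /B/= rsubmx_cone_proj s0 normr0.
have BE p : (phi @` (Uhat `&` B)) p -> exists2 z, cylinder z /\ B z & d.2 z = p.
  move=> [q [Uq Bq] <-].
  have qc : double_cone q by move: Uq; rewrite UE => -[].
  (* Every point of height 0 lifts the vertex; [y0] serves as the representative. *)
  have [q0|q0] := eqVneq (rsubmx q 0 0) 0.
    exists y0; first by split=> //; rewrite /B/= s0 normr0.
    by rewrite dphi// py0 (double_cone0 _ qc q0).
  have [z zc zq] := cone_proj_onto _ qc q0.
  have Bz : B z by move: Bq; rewrite /B/= -zq rsubmx_cone_proj.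
  by exists z => //; rewrite dphi ?zq//; exact: Bd.
have Barc y z : cylinder y -> B y -> cylinder z -> B z -> lsubmx z != - lsubmx y ->
    forall t, 0 <= t <= 1 -> d.1 (cyl_arc y z t).
  move=> yc By zc Bz yz t t01; apply: Bd; first exact: cyl_arc_cylinder.
  move: By Bz; rewrite /B/= row_mxKr !mxE; have /andP[t0 t1] := t01.
  set a := y _ _; set b := z _ _ => ae be.
  apply: le_lt_trans (ler_normD _ _) _.
  rewrite !normrM (ger0_norm t0) ger0_norm ?subr_ge0//.
  rewrite [ltRHS](_ : e = (1 - t) * e + t * e); last by ring.
  have [->|t'] := eqVneq t 1; first by rewrite subrr !mul0r !add0r !mul1r.
  rewrite ltr_leD// ?ltr_pM2l// ?subr_gt0 ?lt_neqAle ?t'//.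
  by rewrite ler_wpM2l// ltW.
move=> U' U'o [p' U'p'] U'U U'S p /BE[z [zc Bz] <-].
have [y [yc By] yp'] := BE _ (U'U _ U'p').
have step w : cylinder w -> B w -> lsubmx w != - lsubmx y -> S (f (d.2 w)).
  move=> wc Bw yw; apply: (arcS U' y) => //.
  - exact: Bd.
  - by rewrite yp'.
  - exact: Barc.
have [zy|] := eqVneq (lsubmx z) (- lsubmx y); last exact: step.
have [v v1 [vy vny]] := sphere_third_point (lsubmx y) m2.
pose w : 'rV[R]_(m + 1) := row_mx v (rsubmx z).
(* By [step], the part of the band not antipodal to [y] is already sent into [S]. Being relatively
   open, it can be the starting set of a second arc, from [w] to [z]; the choice [v != lsubmx y]
   makes these two non-antipodal. *)
pose P := @cylinder R m `&` (B `&` [set w | lsubmx w != - lsubmx y]).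
have Pw : P w.
  split; first by apply/cylinder_dot; rewrite row_mxKl.
  by split=> /=; rewrite /B/= ?row_mxKr// row_mxKl.
have Po : relatively_open (@cylinder R m) P.
  exists (B `&` [set w | lsubmx w != - lsubmx y]) => //; apply: openI => //.
  apply: (@open_comp _ _ (@lsubmx R 1 m 1) [set u | u != - lsubmx y]).
    by move=> ? _; exact: continuous_lsubmx.
  rewrite [X in open X](_ : _ = ~` [set - lsubmx y]); last first.
    by apply/seteqP; split=> u /= /eqP.
  apply: closed_openC; apply: accessible_closed_set1; apply: hausdorff_accessible.
  exact: norm_hausdorff.
apply: (analytically_complete_arc _ _ _ _ w z Sc gan Po Pw) => //.
- by move=> w' [w'c [Bw' w'y]]; exact: step.
- by rewrite row_mxKl zy eqr_opp eq_sym.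
- apply: Barc => //; try by case: Pw => _ [].
    by case: Pw.
  by rewrite row_mxKl zy eqr_opp eq_sym.
Qed.

End DCCoordinates.

(** * Immersions between cylinders are open *)

Section Derivatives.
Context {R : realType}.

Lemma local_min_derive (phi : R -> R) (l : R) : is_derive (0 : R) 1 phi l ->
  (\forall t \near (0 : R), phi 0 <= phi t) -> l = 0.
Proof.
move=> [dphi phil] phimin.
have phicv : (fun h : R => h^-1 *: (phi (h *: (1 : R) + 0) - phi 0)) @ 0^' --> l.
  by rewrite -phil; exact: dphi.
have pm : \forall h \near (0 : R), phi 0 <= phi (h *: (1 : R) + 0).
  by apply: filterS phimin => h; rewrite addr0 [_ *: _]mulr1.
apply/eqP; rewrite eq_le; apply/andP; split.
  apply: (cvgr_to_le (cvg_dnbhs_at_left phicv)).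
  near=> h; have h0 : h < 0 by [].
  rewrite [_ *: _]mulrC mulr_ge0_le0 ?invr_le0 ?(ltW h0)// subr_ge0.
  by near: h; exact: cvg_within.
apply: (cvgr_to_ge (cvg_dnbhs_at_right phicv)).
near=> h; have h0 : 0 < h by [].
rewrite [_ *: _]mulrC mulr_ge0 ?invr_ge0 ?(ltW h0)// subr_ge0.
by near: h; exact: cvg_within.
Unshelve. all: by end_near. Qed.

Lemma is_derive_dot p (h : R -> 'rV[R]_p) (t : R) (w : 'rV[R]_p) :
  is_derive t 1 h w -> is_derive t 1 (fun s => dot (h s) (h s)) (2 * dot (h t) w).
Proof.
move=> hw.
have -> : (fun s => dot (h s) (h s)) =
    \sum_(i < p) ((fun s => h s 0 i) * (fun s => h s 0 i)).
  apply/funext => s; rewrite fct_sumE; exact: eq_bigr.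
have hi i := is_derive_coord _ _ _ _ i hw.
apply: is_derive_eq.
rewrite mulr_sumr; apply: eq_bigr => i _; rewrite /GRing.scale/=; ring.
Qed.

End Derivatives.

(** * Tangent vectors of the cylinder, realised by curves *)

Section CylinderTangent.
Context {R : realType} {m : nat}.
Implicit Types y z v : 'rV[R]_(m + 1).

Lemma cylinder_tangent_dot y v :
  cylinder_tangent y v <-> dot (lsubmx v) (lsubmx y) = 0.
Proof. by rewrite dotC. Qed.

Lemma dot_split y z : dot y z =
  dot (lsubmx y) (lsubmx z) + rsubmx y 0 0 * rsubmx z 0 0.
Proof.
rewrite /dot big_split_ord/= big_ord1 !mxE; congr (_ + _).
by apply: eq_bigr => i _; rewrite !mxE.
Qed.

(* The sphere coordinate is the reflection of [x = lsubmx y] in the line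
   spanned by [x + (t / 2) v]. *)
Definition tangent_curve y v (t : R) : 'rV[R]_(m + 1) :=
  row_mx ((1 + t ^+ 2 * (dot (lsubmx v) (lsubmx v) / 4))^-1 *:
            (2 *: lsubmx y + t *: lsubmx v) - lsubmx y)
         (rsubmx y + t *: rsubmx v).

Lemma tangent_curve0 y v : tangent_curve y v 0 = y.
Proof.
rewrite /tangent_curve expr0n/= mul0r addr0 invr1 scale1r !scale0r !addr0.
by rewrite scaler_nat mulr2n addrK hsubmxK.
Qed.

Lemma tangent_curve_denom v (t : R) :
  0 < 1 + t ^+ 2 * (dot (lsubmx v) (lsubmx v) / 4).
Proof. by rewrite ltr_wpDr// mulr_ge0 ?sqr_ge0// divr_ge0// dot_ge0. Qed.

Lemma tangent_curve_cylinder y v t : cylinder y -> cylinder_tangent y v ->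
  cylinder (tangent_curve y v t).
Proof.
move=> /cylinder_dot y1 /cylinder_tangent_dot vy; apply/cylinder_dot.
have := tangent_curve_denom v t.
rewrite row_mxKl !(dotDl,dotDr,dotNl,dotNr,dotZl,dotZr) y1 (dotC _ (lsubmx v)) vy.
set q := dot _ _ => q0; field; lra.
Qed.

Lemma is_derive_tangent_curve y v : is_derive (0 : R) 1 (tangent_curve y v) v.
Proof.
apply: is_derive_row => i; have [j ->|j ->] := split_ordP i.
  set q := dot (lsubmx v) (lsubmx v) / 4.
  have -> : (fun s => tangent_curve y v s 0 (lshift 1 j) : R) =
     (fun s => (1 + s * s * q)^-1) * (fun s => 2 * lsubmx y 0 j + s * lsubmx v 0 j)
     + cst (- lsubmx y 0 j).
    by apply/funext => s; rewrite /tangent_curve row_mxEl !mxE !fctE/= ?mxE expr2.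
  have -> : v 0 (lshift 1 j) = lsubmx v 0 j by rewrite mxE.
  have D : is_derive (0 : R) 1 (fun s : R => 1 + s * s * q) 0.
    have -> : (fun s : R => 1 + s * s * q) = cst 1 + id * id * cst q by [].
    by apply: is_derive_eq; rewrite /GRing.scale/=; ring.
  have N : is_derive (0 : R) 1 (fun s : R =>
    2 * lsubmx y 0 j + s * lsubmx v 0 j) (lsubmx v 0 j).
    have -> : (fun s : R => 2 * lsubmx y 0 j + s * lsubmx v 0 j) =
      cst (2 * lsubmx y 0 j) + id * cst (lsubmx v 0 j) by [].
    by apply: is_derive_eq; rewrite /GRing.scale/=; ring.
  have D1 : is_derive (0 : R) 1 (fun s : R => (1 + s * s * q)^-1) 0.
    have n0 : 1 + 0 * 0 * q != 0 by rewrite !mul0r addr0 oner_neq0.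
    apply: (is_derive_eq (@is_deriveV _ (fun s => 1 + s * s * q) _ _ _ n0 D)).
    by rewrite scaler0.
  apply: is_derive_eq; rewrite /GRing.scale/= !mul0r !addr0 invr1; ring.
have -> : (fun s => tangent_curve y v s 0 (rshift m j) : R) =
   cst (rsubmx y 0 j) + id * cst (rsubmx v 0 j).
  by apply/funext => s; rewrite /tangent_curve row_mxEr !mxE !fctE/= ?mxE.
have -> : v 0 (rshift m j) = rsubmx v 0 j by rewrite mxE.
by apply: is_derive_eq; rewrite /GRing.scale/=; ring.
Qed.

Lemma tangent_curve_continuous0 y v : tangent_curve y v @ (0 : R) --> y.
Proof.
rewrite -[in X in _ --> X](tangent_curve0 y v).
apply: differentiable_continuous; apply/derivable1_diffP.
by have [] := is_derive_tangent_curve y v.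
Qed.

Lemma lsubmxD y z : lsubmx (y + z) = lsubmx y + lsubmx z.
Proof. exact: linearD. Qed.

Lemma lsubmxZ c y : lsubmx (c *: y) = c *: lsubmx y.
Proof. exact: linearZ. Qed.

Definition cylinder_normal y : 'rV[R]_(m + 1) := row_mx (lsubmx y) 0.

Lemma lsubmx_normal y : lsubmx (cylinder_normal y) = lsubmx y.
Proof. by rewrite row_mxKl. Qed.

Lemma rsubmx_normal y : rsubmx (cylinder_normal y) 0 0 = 0.
Proof. by rewrite row_mxKr mxE. Qed.

(* A linear map that embeds the tangent space at [y] into the one at [z] is
   completed, normal to normal, into an automorphism [K] of the ambient space. *)
Lemma tangent_extension y z (J : 'M[R]_(m + 1)) :
  cylinder y -> cylinder z ->
  (forall v, cylinder_tangent y v -> cylinder_tangent z (v *m J)) ->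
  (forall v, cylinder_tangent y v -> v *m J = 0 -> v = 0) ->
  exists2 K : 'M[R]_(m + 1), K \in unitmx &
    forall v, let c := dot (lsubmx v) (lsubmx y) in
      v *m K = (v - c *: cylinder_normal y) *m J + c *: cylinder_normal z
      /\ cylinder_tangent y (v - c *: cylinder_normal y).
Proof.
move=> /cylinder_dot y1 /cylinder_dot z1 JT J0.
pose ny := cylinder_normal y; pose nz := cylinder_normal z.
(* A rank one correction: it vanishes on vectors tangent at [y], and it makes [K] send the unit
   normal [ny] to [nz]. *)
pose K := J + ny^T *m (nz - ny *m J).
have tan v : cylinder_tangent y (v - dot (lsubmx v) (lsubmx y) *: ny).
  apply/cylinder_tangent_dot; rewrite linearB linearZ/= lsubmx_normal.
  by rewrite dotDl dotNl dotZl y1 mulr1 subrr.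
have KE v : v *m K = (v - dot (lsubmx v) (lsubmx y) *: ny) *m J
    + dot (lsubmx v) (lsubmx y) *: nz.
  rewrite mulmxDr mulmxA [v *m _^T]mx11_scalar mul_scalar_mx.
  have -> : (v *m ny^T) 0 0 = dot (lsubmx v) (lsubmx y).
    rewrite mxE -[RHS]addr0; transitivity (dot v ny).
      by apply: eq_bigr => i _; rewrite mxE.
    by rewrite dot_split lsubmx_normal rsubmx_normal mulr0.
  by rewrite scalerBr mulmxBl scalemxAl addrA addrAC.
exists K => [|v]; last by split; [exact: KE|exact: tan].
rewrite -row_free_unit; apply: inj_row_free => v.
rewrite KE; set c := dot _ _ => E.
have c0 : c = 0.
  have /cylinder_tangent_dot := JT _ (tan v); rewrite -/c => T.
  have := congr1 (fun w => dot (lsubmx w) (lsubmx z)) E.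
  rewrite /= lsubmxD (lsubmxZ c nz) lsubmx_normal dotDl dotZl z1 mulr1 T add0r.
  by rewrite linear0 -(scale0r (lsubmx z)) dotZl mul0r.
move: E (tan v); rewrite -/c c0 !scale0r addr0 subr0 => E T; exact: J0.
Qed.

End CylinderTangent.

(** * Openness of an immersion of the cylinder by minimisation *)

Section OpenImage.
Context {R : realType} {m : nat}.
Implicit Types y z v : 'rV[R]_(m + 1).

Lemma mulmx_norm_le p q (J : 'M[R]_(p, q)) :
  exists2 C : R, 0 < C & forall h : 'rV[R]_p, `|h *m J| <= C * `|h|.
Proof.
exists (1 + \sum_(i < p) \sum_(j < q) `|J i j|).
  by rewrite ltr_pwDl// sumr_ge0// => i _; rewrite sumr_ge0.
move=> h; apply: rV_norm_le => [|j].
  by rewrite mulr_ge0// addr_ge0// sumr_ge0// => i _; rewrite sumr_ge0.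
rewrite mxE; apply: le_trans (ler_norm_sum _ _ _) _.
rewrite mulrDl mul1r; apply: ler_wpDl => //; rewrite mulr_suml.
apply: ler_sum => i _; rewrite normrM mulrC; apply: ler_pM => //.
  by rewrite (bigD1 j)//= lerDl sumr_ge0.
exact: rV_coord_le.
Qed.

Lemma dot_le_norm p (u : 'rV[R]_p) : dot u u <= p%:R * `|u| ^+ 2.
Proof.
rewrite dot_sqr; apply: (@le_trans _ _ (\sum_(j < p) `|u| ^+ 2)).
  apply: ler_sum => j _; rewrite -real_normK ?num_real// lerXn2r ?nnegrE//.
  exact: rV_coord_le.
by rewrite sumr_const card_ord mulr_natl.
Qed.

Lemma lsubmx_norm_le y : `|lsubmx y| <= `|y|.
Proof. by apply: rV_norm_le => // i; rewrite mxE; exact: rV_coord_le. Qed.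

Lemma dotD_le p (a b : 'rV[R]_p) : dot (a + b) (a + b) <= 2 * dot a a + 2 * dot b b.
Proof.
have := dot_ge0 (a - b).
rewrite !(dotDl,dotDr,dotNl,dotNr) (dotC b a); lra.
Qed.

Lemma continuous_dot_shift p (z : 'rV[R]_p) :
  continuous (fun y : 'rV[R]_p => dot (y - z) (y - z)).
Proof.
move=> y; apply: (cvg_big _ (nbhs_filter y)); first exact: add_continuous.
move=> i _; have H : (fun x : 'rV[R]_p => (x - z) 0 i) @ y --> (y - z) 0 i.
  rewrite mxE; under eq_fun do rewrite mxE.
  apply: (@cvgD _ _ _ (nbhs y) (nbhs_filter y)); last exact: cvg_cst.
  exact: coord_continuous.
exact: (@cvgM _ _ (nbhs y) (nbhs_filter y) _ _ _ _ H H).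
Qed.

Lemma cylinder_closed : closed (@cylinder R m).
Proof.
rewrite [X in closed X](_ : _ =
  (fun y => dot (lsubmx y - 0) (lsubmx y - 0)) @^-1` [set 1 : R]); last first.
  by apply/seteqP; split=> y /=; rewrite subr0 => /cylinder_dot.
apply: preimage_closed => [y _|].
  apply: (@continuous_comp _ _ _ (@lsubmx R 1 m 1) (fun u => dot (u - 0) (u - 0))).
    exact: continuous_lsubmx.
  exact: continuous_dot_shift.
by apply: accessible_closed_set1; apply: hausdorff_accessible; exact: norm_hausdorff.
Qed.

Definition sqdist {p} (a b : 'rV[R]_p) : R := dot (a - b) (a - b).

Lemma compact_cylinder_ball y0 (r : R) :
  compact [set y | cylinder y /\ `|y - y0| <= r].
Proof.
apply: bounded_closed_compact.
  exists (r + `|y0|); split; first exact: num_real.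
  move=> M rM y [_ yr]; apply: ltW; apply: le_lt_trans rM.
  by rewrite -[y](subrK y0) (le_trans (ler_normD _ _))// lerD2r.
rewrite [X in closed X](_ : _ = @cylinder R m `&`
  (fun y => `|y - y0|) @^-1` [set s | s <= r])//.
apply: closedI; first exact: cylinder_closed.
apply: preimage_closed; last exact: closed_le.
move=> y _; apply: (@cvg_norm _ _ _ _ (nbhs_filter y)).
by apply: (@cvgB _ _ _ (nbhs y) (nbhs_filter y)); [exact: cvg_id|exact: cvg_cst].
Qed.

Lemma compact_cylinder_sphere y0 (r : R) :
  compact [set y | cylinder y /\ `|y - y0| = r].
Proof.
apply: (@subclosed_compact _ _ [set y | cylinder y /\ `|y - y0| <= r]).
- rewrite [X in closed X](_ : _ = @cylinder R m `&`
    (fun y => `|y - y0|) @^-1` [set r])//.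
  apply: closedI; first exact: cylinder_closed.
  apply: preimage_closed.
    move=> y _; apply: (@cvg_norm _ _ _ _ (nbhs_filter y)).
    by apply: (@cvgB _ _ _ (nbhs y) (nbhs_filter y)); [exact: cvg_id|exact: cvg_cst].
  by apply: accessible_closed_set1; apply: hausdorff_accessible;
    exact: norm_hausdorff.
- exact: compact_cylinder_ball.
- by move=> y [yc yr]; split=> //; rewrite yr.
Qed.

Context {A : set 'rV[R]_(m + 1)} {G : 'rV[R]_(m + 1) -> 'rV[R]_(m + 1)}.
Context (Aopen : relatively_open (@cylinder R m) A)
  (Gcyl : forall y, A y -> cylinder (G y))
  (Gdiff : forall y, A y -> exists F : 'rV[R]_(m + 1) -> 'rV[R]_(m + 1),
    [/\ differentiable F y, (\forall x \near y, A x -> G x = F x) &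
      forall v, cylinder_tangent y v -> 'd F y v = 0 -> v = 0]).

(** Tangent vectors go to tangent vectors because, along a curve in the cylinder, the sphere
    component of [G] keeps squared length 1, and the derivative of this constant is twice the dot
    product in question. *)
Lemma immersion_matrix y : A y -> exists F (J : 'M[R]_(m + 1)),
    [/\ differentiable F y, (\forall x \near y, A x -> G x = F x),
      (forall v, 'd F y v = v *m J),
      (forall v, cylinder_tangent y v -> cylinder_tangent (G y) (v *m J))
    & forall v, cylinder_tangent y v -> v *m J = 0 -> v = 0].
Proof.
move=> Ay; have [F [dF GF inj]] := Gdiff _ Ay.
have [W Wo AE] := Aopen.
have JE v : 'd F y v = v *m lin1_mx ('d F y) by rewrite mul_rV_lin1.
exists F, (lin1_mx ('d F y)); split => // v yv; last by rewrite -JE; exact: inj.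
rewrite -JE; have [yc Wy] : cylinder y /\ W y by move: Ay; rewrite AE.
have gam0 := tangent_curve0 y v.
have D1 : is_derive (0 : R) 1 (F \o tangent_curve y v) ('d F y v).
  rewrite -[in 'd F y](gam0); apply: is_derive_comp_curve; first by rewrite gam0.
  exact: is_derive_tangent_curve.
have D2 : is_derive (0 : R) 1 (lsubmx \o (F \o tangent_curve y v)) (lsubmx ('d F
  y v)).
  apply: is_derive_row => i; have := is_derive_coord _ _ _ _ (lshift 1 i) D1.
  rewrite mxE; congr is_derive; by apply/funext => s; rewrite /= mxE.
have D3 := is_derive_dot _ _ _ _ D2.
have : is_derive (0 : R) 1 (cst (1 : R)) (2 * dot (lsubmx (F y)) (lsubmx ('d F y v))).
  apply: near_eq_is_derive; last by move: D3; rewrite /= gam0; apply.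
  have gc := tangent_curve_continuous0 y v.
  near=> t; have At : A (tangent_curve y v t).
    rewrite AE; split; first exact: tangent_curve_cylinder.
    by near: t; apply: gc; exact: open_nbhs_nbhs.
  have GFt : A (tangent_curve y v t) -> G (tangent_curve y v t) = F
    (tangent_curve y v t).
    by near: t; exact: (gc _ GF).
  by rewrite /= -GFt//; have /cylinder_dot -> := Gcyl _ At.
move=> [_]; rewrite derive_cst => /esym/eqP; rewrite mulf_eq0 pnatr_eq0/= => /eqP E.
by apply/cylinder_tangent_dot; rewrite dotC (nbhs_singleton GF).
Unshelve. all: by end_near. Qed.

(** The chord [h = y - y0] has both ends on the cylinder, so its normal component is quadratic in
    [h], and [h *m K] differs from [h *m J] by a quadratic term. If [G y = G y0], then [h *m J] is
    of smaller order than [h]; as [K] is invertible, a small [h] must be 0. *)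
Lemma locally_injective_immersion y0 : A y0 ->
  \forall y \near y0, A y -> G y = G y0 -> y = y0.
Proof.
move=> Ay0; have [F [J [dF GF dFJ JT Jinj]]] := immersion_matrix _ Ay0.
have [W Wo AE] := Aopen.
have y0c : cylinder y0 by move: Ay0; rewrite AE => -[].
have [K Ku KE] := tangent_extension _ _ _ y0c (Gcyl _ Ay0) JT Jinj.
have [C C0 CK] := mulmx_norm_le _ _ (invmx K).
pose b := cylinder_normal (G y0) - cylinder_normal y0 *m J.
(* The summand 1 keeps [B] positive. With the bounds [(4 * C)^-1] and [(4 * B)^-1] below, the linear
   and the quadratic error each contribute at most a quarter of [|h|]. *)
pose B := C * (m%:R / 2 * `|b|) + 1.
have B0 : 0 < B by rewrite ltr_wpDl// mulr_ge0 ?(ltW C0)// mulr_ge0// divr_ge0.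
have e0 : 0 < (4 * C)^-1 by rewrite invr_gt0 mulr_gt0.
have d0 : 0 < (4 * B)^-1 by rewrite invr_gt0 mulr_gt0.
have Fe := differentiable_eps _ _ _ _ _ dF e0.
have near0 (P : set 'rV[R]_(m + 1)) : (\forall h \near (0 : 'rV[R]_(m+1)), P h) ->
    \forall y \near y0, P (y - y0).
  move=> P0; have : (fun y => y - y0) @ y0 --> y0 - y0.
    by apply: (@cvgB _ _ _ (nbhs y0) (nbhs_filter y0));
      [exact: cvg_id|exact: cvg_cst].
  by rewrite subrr; apply.
have H1 := near0 _ Fe.
have H2 := near0 _ (@nbhs0_le _ 'rV[R]_(m + 1) _ d0).
have H := @filterI _ (nbhs y0) (nbhs_filter y0) _ _ GF (@filterI _ (nbhs y0)
  (nbhs_filter y0) _ _ H1 H2).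
apply: (@filterS _ (nbhs y0) (nbhs_filter y0) _ _ _ H) => y [yGF [+ yd]] Ay GE.
set h := y - y0 in yd *.
have Fy : F (y0 + h) = F y0.
  by rewrite /h addrC subrK -yGF// GE (nbhs_singleton GF).
rewrite Fy subrr sub0r normrN dFJ => hJ.
have yc : cylinder y by move: Ay; rewrite AE => -[].
pose c := dot (lsubmx h) (lsubmx y0).
have cE : c = - (dot (lsubmx h) (lsubmx h) / 2).
  have /cylinder_dot := yc; rewrite -(subrK y0 y) -/h lsubmxD.
  have /cylinder_dot y01 := y0c.
  by rewrite dotDl !dotDr y01 (dotC (lsubmx y0)) -/c; lra.
have hK : h *m K = h *m J + c *: b.
  by rewrite (KE h).1 -/c mulmxBl scalerBr scalemxAl addrA addrAC.
have cle : `|c| <= m%:R / 2 * `|h| ^+ 2.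
  rewrite cE normrN ger0_norm ?divr_ge0 ?dot_ge0//.
  rewrite mulrAC ler_wpM2r// (le_trans (dot_le_norm _ _))// ler_wpM2l//.
  by rewrite lerXn2r ?nnegrE// lsubmx_norm_le.
have hle : `|h| <= C * ((4 * C)^-1 * `|h| + m%:R / 2 * `|h| ^+ 2 * `|b|).
  rewrite -[in leLHS](mulmxK Ku h); apply: le_trans (CK _) _.
  rewrite ler_wpM2l ?(ltW C0)// hK (le_trans (ler_normD _ _))// lerD//.
  by rewrite normrZ ler_wpM2r.
have h4 : `|h| <= `|h| / 4 + B * `|h| * `|h|.
  apply: (le_trans hle); rewrite mulrDr lerD//.
    by rewrite mulrA invfM [C * _]mulrC mulfVK ?gt_eqF// mulrC.
  rewrite /B [leRHS](_ : _ = C * (m%:R / 2 * `|h| ^+ 2 * `|b|) + `|h| ^+ 2);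
    last by ring.
  by rewrite lerDl.
have : B * `|h| * `|h| <= `|h| / 4.
  rewrite [leRHS]mulrC ler_wpM2r//.
  apply: (@le_trans _ _ (B * (4 * B)^-1)); first by rewrite ler_wpM2l ?(ltW B0).
  by rewrite invfM mulrCA mulfV ?mulr1// gt_eqF.
move=> h4'; have : `|h| <= 0 by lra.
by rewrite normr_le0 subr_eq0 => /eqP.
Qed.

Lemma sqdist_continuous (B : set 'rV[R]_(m + 1)) z : B `<=` A ->
  {within B, continuous (fun y => sqdist (G y) z)}.
Proof.
move=> BA; apply/subspace_continuousP => y By.
have [F [dF GF _]] := Gdiff _ (BA _ By).
have Fc := differentiable_continuous dF.
apply: (cvg_comp G (fun u => sqdist u z)); last exact: continuous_dot_shift.
rewrite (nbhs_singleton GF (BA _ By)) => P /Fc FP.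
apply: (@filterS _ (nbhs y) (nbhs_filter y) _ _ _
  (@filterI _ (nbhs y) (nbhs_filter y) _ _ GF FP)) => x [GFx Fx] Bx.
by rewrite /= GFx//; exact: BA.
Qed.

(* At a minimum of the distance to [z] along [G], [G y - z] is normal to the
   cylinder at [G y]; a nontrivial chord of the cylinder in the normal direction
   joins antipodal points. *)
Lemma critical_point_eq y z : A y -> cylinder z -> sqdist (G y) z < 4 ->
  (forall v, cylinder_tangent y v -> \forall t \near (0 : R),
     sqdist (G y) z <= sqdist (G (tangent_curve y v t)) z) ->
  G y = z.
Proof.
move=> Ay zc Gz4 ymin.
have [F [J [dF GF dFJ JT Jinj]]] := immersion_matrix _ Ay.
have [W Wo AE] := Aopen.
have [yc Wy] : cylinder y /\ W y by move: Ay; rewrite AE.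
set w := G y - z.
have orth v : cylinder_tangent y v -> dot w (v *m J) = 0.
  move=> yv; have gam0 := tangent_curve0 y v;
    have gc := tangent_curve_continuous0 y v.
  have D1 : is_derive (0 : R) 1 (F \o tangent_curve y v) (v *m J).
    rewrite -dFJ -[in 'd F y](gam0); apply: is_derive_comp_curve;
      first by rewrite gam0.
    exact: is_derive_tangent_curve.
  have D2 : is_derive (0 : R) 1 (fun t => F (tangent_curve y v t) - z) (v *m J).
    have -> : (fun t => F (tangent_curve y v t) - z) = (F \o tangent_curve y v) +
      cst (- z) by [].
    apply: (is_derive_eq (is_deriveD D1 (is_derive_cst (- z) _ _))).
    by rewrite addr0.
  have D3 := is_derive_dot _ _ _ _ D2.
  have : 2 * dot (F (tangent_curve y v 0) - z) (v *m J) = 0.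
    apply: local_min_derive D3 _.
    near=> t; have At : A (tangent_curve y v t).
      rewrite AE; split; first exact: tangent_curve_cylinder.
      by near: t; apply: gc; exact: open_nbhs_nbhs.
    have GFt : A (tangent_curve y v t) -> G (tangent_curve y v t) = F
      (tangent_curve y v t).
      by near: t; exact: (gc _ GF).
    rewrite -GFt// gam0 -(nbhs_singleton GF)//; near: t; exact: ymin.
  rewrite gam0 -(nbhs_singleton GF)// => /eqP; rewrite mulf_eq0 pnatr_eq0/= => /eqP.
  by [].
have Gyc := Gcyl _ Ay.
have [K Ku KE] := tangent_extension _ _ _ yc Gyc JT Jinj.
(* Invertibility of [K] splits [w] into the image under [J] of a tangent vector and a multiple of
   the normal at [G y]; [orth] forces the first part to vanish. *)
have [wE vT] := KE (w *m invmx K); rewrite mulmxKV// in wE.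
move: wE vT; set c := dot (lsubmx (w *m _)) _; set v := _ - _ *: _ => wE vT.
have vJ0 : v *m J = 0.
  apply: dot_eq0; have := orth _ vT; rewrite wE dotDl dotZl.
  have /cylinder_tangent_dot := JT _ vT.
  rewrite (dotC (cylinder_normal _)) [dot _ (cylinder_normal _)]dot_split
    lsubmx_normal => ->.
  by rewrite rsubmx_normal mulr0 !(addr0,mulr0).
have wn : w = c *: cylinder_normal (G y) by rewrite wE vJ0 add0r.
have /cylinder_dot G1 := Gyc; have /cylinder_dot z1 := zc.
have nn : dot (cylinder_normal (G y)) (cylinder_normal (G y)) = 1.
  by rewrite dot_split lsubmx_normal G1 rsubmx_normal mulr0 addr0.
have c4 : c ^+ 2 < 4 by move: Gz4; rewrite /sqdist -/w wn dotZl dotZr nn mulr1 -expr2.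
have zE : z = G y - w by rewrite /w opprB addrC subrK.
(* The sphere component of [z] is [1 - c] times that of [G y], and both are unit vectors. The root 2
   would put [z] at squared distance 4. *)
have : c * (c - 2) = 0.
  have := z1; rewrite zE wn -scaleNr lsubmxD lsubmxZ lsubmx_normal.
  rewrite !(dotDl,dotDr,dotZl,dotZr) G1; lra.
move=> /eqP; rewrite mulf_eq0 subr_eq0 => /orP[/eqP c0|/eqP c2].
  by rewrite zE wn c0 scale0r subr0.
by move: c4; rewrite c2 -natrX ltxx.
Unshelve. all: by end_near. Qed.

(** For [z] near [G y0], the squared distance from [G y] to [z] is minimised over a compact ball [D]
    around [y0]. Local injectivity keeps [G] away from [G y0] on the boundary [bD], so the minimum
    is attained inside and [critical_point_eq] applies. Differentiability at each point is all that
    this uses; no continuity of the differential enters. *)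
Lemma cylinder_open_image y0 : A y0 ->
  exists2 eta, 0 < eta & cap eta (G y0) `<=` G @` A.
Proof.
move=> Ay0; have [W Wo AE] := Aopen.
have [y0c Wy0] : cylinder y0 /\ W y0 by move: Ay0; rewrite AE.
have inj := locally_injective_immersion _ Ay0.
have [r r0 rP] : exists2 r : R, 0 < r & forall y, `|y - y0| <= r ->
    W y /\ (A y -> G y = G y0 -> y = y0).
  have : nbhs y0 (W `&` [set y | A y -> G y = G y0 -> y = y0]).
    by apply: filterI => //; exact: open_nbhs_nbhs.
  move=> /nbhs_ballP[e /= e0 eW]; exists (e / 2); first by rewrite divr_gt0.
  move=> y ye; apply: eW; rewrite -ball_normE /ball_/= distrC.
  by apply: le_lt_trans ye _; rewrite ltr_pdivrMr// ltr_pMr// ltr1n.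
pose D := [set y | cylinder y /\ `|y - y0| <= r].
pose bD := [set y | cylinder y /\ `|y - y0| = r].
have DA : D `<=` A by move=> y [yc /rP[Wy _]]; rewrite AE.
have bDD : bD `<=` D by move=> y [yc yr]; split=> //; rewrite yr.
have [del del0 bDdel] : exists2 del : R, 0 < del &
    forall y, bD y -> del <= sqdist (G y) (G y0).
  have [bD0|bD0] := pselect (bD !=set0); last first.
    by exists 1 => // y yD; case: bD0; exists y.
  have [y1 /set_mem y1D y1min] := EVT_min_rV bD0 (compact_cylinder_sphere y0 r)
    (sqdist_continuous _ (G y0) (subset_trans bDD DA)).
  exists (sqdist (G y1) (G y0)); last by move=> y yD; apply: y1min; exact/mem_set.
  rewrite lt_neqAle dot_ge0 andbT eq_sym; apply/negP => /eqP /dot_eq0 /eqP.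
  rewrite subr_eq0 => /eqP GE.
  have [_ y1r] := y1D.
  have y1y0 : y1 = y0 by apply: (rP y1 _).2 => //; [rewrite y1r|exact/DA/bDD].
  by move: r0; rewrite -y1r y1y0 subrr normr0 ltxx.
(* On the cap the squared distance to [G y0] is below [3 * eta]: at most 3, hence below the 4 of
   [critical_point_eq], and at most [del / 4]. By [dotD_le], a minimum on the boundary would give
   [del] at most 4 times that distance, a contradiction. *)
exists (Num.min 1 (del / 12)); first by rewrite lt_min ltr01 divr_gt0.
move=> z [zc zd zs].
have zGz : sqdist (G y0) z < 3 /\ sqdist (G y0) z < del / 4.
  have /cylinder_dot G1 := Gcyl _ Ay0; have /cylinder_dot z1 := zc.
  have E : sqdist (G y0) z = 2 - 2 * dot (lsubmx z) (lsubmx (G y0)) +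
      (rsubmx z 0 0 - rsubmx (G y0) 0 0) ^+ 2.
    rewrite /sqdist dot_split -scaleN1r lsubmxD lsubmxZ.
    rewrite !(dotDl,dotDr,dotZl,dotZr) G1 z1 (dotC (lsubmx (G y0))) !mxE; ring.
  have e1 : Num.min 1 (del / 12) <= 1 by rewrite ge_min lexx.
  have e2 : Num.min 1 (del / 12) <= del / 12 by rewrite ge_min lexx orbT.
  rewrite E; move: zd zs e1 e2; set eta := Num.min _ _; split; lra.
have Dy0 : D y0 by split=> //; rewrite subrr normr0 ltW.
have D0 : D !=set0 by exists y0.
have [y1 /set_mem y1D y1min] := EVT_min_rV D0 (compact_cylinder_ball y0 r)
    (sqdist_continuous _ z DA).
have y1y0 : sqdist (G y1) z <= sqdist (G y0) z by apply: y1min; exact/mem_set.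
exists y1; first exact: DA.
have [y1c y1r] := y1D.
have {}y1r : `|y1 - y0| < r.
  rewrite lt_neqAle y1r andbT; apply/negP => /eqP y1E.
  have := bDdel y1 (conj y1c y1E).
  have := dotD_le _ (G y1 - z) (z - G y0); rewrite subrKA.
  have -> : dot (z - G y0) (z - G y0) = sqdist (G y0) z.
    by rewrite -(opprB (G y0)) dotNl dotNr opprK.
  rewrite -!/(sqdist _ _); case: zGz; lra.
apply: critical_point_eq => //; first exact: DA.
  by case: zGz; lra.
move=> v y1v; have gc := tangent_curve_continuous0 y1 v.
have : \forall x \near y1, `|x - y0| < r.
  have : (fun x => `|x - y0|) @ y1 --> `|y1 - y0|.
    apply: (@cvg_norm _ _ _ _ (nbhs_filter y1)).
    by apply: (@cvgB _ _ _ (nbhs y1) (nbhs_filter y1));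
      [exact: cvg_id|exact: cvg_cst].
  by move=> /(@cvgr_lt _ _ _ (nbhs_filter y1)); apply.
move=> H; apply: (@filterS _ (nbhs (0 : R)) _ _ _ _ (gc _ H)) => t tr;
  apply: y1min; apply/mem_set; split.
  exact: tangent_curve_cylinder.
exact: ltW.
Qed.

End OpenImage.

(** * Analytic extensions *)

Section Extension.
Context {R : realType} {m n : nat} {N : analytic_manifold R n}.

Lemma relatively_openI (T : topologicalType) (C A B : set T) :
  relatively_open C A -> relatively_open C B -> relatively_open C (A `&` B).
Proof.
move=> [V Vo ->] [W Wo ->]; exists (V `&` W); first exact: openI.
by rewrite setIACA setIid.
Qed.

(** In a chart of [N], the local extensions satisfy [F1 = F2 \o E] on the cylinder near [y], where
    [F1] represents [f] and [F2] represents [f2]. Differentiating along a curve in the cylinder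
    shows that a tangent vector killed by ['d E y] is killed by ['d F1 y], which is injective on
    tangent vectors. Curves are used because the equality is known only on the cylinder. *)
Lemma lift_differential_injective (X X2 : dc_manifold R m) (f : X -> N)
    (f2 : X2 -> N) (phi : X -> X2) c d F E y :
  dc_atlas c -> dc_atlas d -> is_dc_map_to_manifold f2 ->
  (forall x, f x = f2 (phi x)) ->
  relatively_open (@cylinder R m) (dc_lift_domain phi c d) ->
  (forall x, dc_lift_domain phi c d x -> d.1 (F x) /\ d.2 (F x) = phi (c.2 x)) ->
  dc_lift_domain phi c d y -> immersion_at f (c.2 y) ->
  analytic_at E y -> (\forall x \near y, dc_lift_domain phi c d x -> F x = E x) ->
  forall v, cylinder_tangent y v -> 'd E y v = 0 -> v = 0.
Proof.
move=> cX dX2 f2an ff2 [W Wo LE] FP Ly fimm Ean FE v yv Ev.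
have [_ ch_cover _] := (am_atlasP N).1.
have [ch chN chf] := ch_cover (f (c.2 y)).
have cy : c.1 y by case: Ly.
have [F1 [F1an F1E F1inj]] := fimm c y cX cy erefl ch chN chf.
have FyE : F y = E y by exact: (nbhs_singleton FE).
have [dFy dFyE] := FP _ Ly.
have [F2 F2an F2E] : analytic_within d.1 (ch.2 \o (f2 \o d.2)) (F y).
  by apply: (f2an d dX2).2 => //=; rewrite dFyE -ff2.
apply: F1inj => //.
have gam0 := tangent_curve0 y v; have gc := tangent_curve_continuous0 y v.
have [yc Wy] : cylinder y /\ W y by move: Ly; rewrite LE.
have dEy := analytic_differentiable _ _ _ _ Ean.
have D1 : is_derive (0 : R) 1 (F1 \o tangent_curve y v) ('d F1 y v).
  rewrite -[in 'd F1 y](gam0); apply: is_derive_comp_curve.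
    by rewrite gam0; exact: analytic_differentiable.
  exact: is_derive_tangent_curve.
have DE : is_derive (0 : R) 1 (E \o tangent_curve y v) ('d E y v).
  rewrite -[in 'd E y](gam0); apply: is_derive_comp_curve; first by rewrite gam0.
  exact: is_derive_tangent_curve.
have D2 : is_derive (0 : R) 1 (F2 \o (E \o tangent_curve y v)) ('d F2 (E y) ('d E
  y v)).
  rewrite -[in 'd F2 (E y)](gam0); apply: is_derive_comp_curve => //=.
  by rewrite gam0 -FyE; exact: analytic_differentiable.
have Ec : E @ y --> F y by rewrite FyE; exact: differentiable_continuous.
have D3 : is_derive (0 : R) 1 (F1 \o tangent_curve y v) ('d F2 (E y) ('d E y v)).
  apply: near_eq_is_derive D2.
  near=> t; have Lt : dc_lift_domain phi c d (tangent_curve y v t).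
    rewrite LE; split; first exact: tangent_curve_cylinder.
    by near: t; apply: gc; exact: open_nbhs_nbhs.
  have Fx : dc_lift_domain phi c d (tangent_curve y v t) ->
      F (tangent_curve y v t) = E (tangent_curve y v t) by near: t; exact: (gc _ FE).
  have F1x : c.1 (tangent_curve y v t) ->
      ch.2 (f (c.2 (tangent_curve y v t))) = F1 (tangent_curve y v t) by near: t;
        exact: (gc _ F1E).
  have F2x : d.1 (E (tangent_curve y v t)) ->
      ch.2 (f2 (d.2 (E (tangent_curve y v t)))) = F2 (E (tangent_curve y v t)).
    by near: t; exact: (gc _ (Ec _ F2E)).
  have [dFx dFxE] := FP _ Lt.
  rewrite /= -F2x -?Fx// dFxE -ff2 F1x//.
  by case: Lt.
have [_ <-] := D1; have [_ ->] := D3.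
by rewrite Ev linear0.
Unshelve. all: by end_near. Qed.

(** Height 0 is crushed to the vertex, and the image of a cap may fail to be a neighbourhood there.
    At nonzero height [cone_cap] supplies an open set, so a cap centred at height 0 is probed at a
    slightly shifted point. *)
Lemma cap_nonzero_height (eta : R) (z0 : 'rV[R]_(m + 1)) : 0 < eta -> cylinder z0 ->
  exists2 z, cap eta z0 z & rsubmx z 0 0 != 0.
Proof.
move=> e0 z0c; have [s0|s0] := eqVneq (rsubmx z0 0 0) 0; last first.
  by exists z0 => //; exact: cap_self.
pose s := Num.min 1 eta / 2.
have m0 : 0 < Num.min 1 eta by rewrite lt_min ltr01.
exists (row_mx (lsubmx z0) s%:M); last by rewrite row_mxKr mxE/= mulr1n gt_eqF
  ?divr_gt0.
have /cylinder_dot z1 := z0c; split; rewrite ?row_mxKl ?row_mxKr.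
- by apply/cylinder_dot; rewrite row_mxKl.
- by rewrite z1 ltrBlDr ltrDl.
- rewrite s0 subr0 mxE/= mulr1n /s.
  have m1 : Num.min 1 eta <= 1 by rewrite ge_min lexx.
  have me : Num.min 1 eta <= eta by rewrite ge_min lexx orbT.
  move: m0 m1 me; set k := Num.min _ _ => *; nra.
Qed.

Lemma dc_map_image_interior (X X2 : dc_manifold R m) (f : X -> N)
    (f2 : X2 -> N) (phi : X -> X2) :
  [set: X] !=set0 -> m_dimensional f -> is_dc_map_to_manifold f2 -> is_dc_map phi ->
  (forall x, f x = f2 (phi x)) -> (f2 @^-1` range f)° !=set0.
Proof.
move=> [x0 _] [D [Do Dd _ Dimm]] f2an phidc ff2.
have [p [_ Dp]] : [set: X] `&` D !=set0.
  by apply: Dd; [exists x0|exact: openT].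
have [[ccoord ccover _] _] := dc_atlasP X; have [[dcoord dcover _] _] := dc_atlasP X2.
have [c cX [y0 cy0 y0p]] := ccover p.
have [d dX2 dphi] := dcover (phi p).
have [Lo [F Fan FP]] := phidc c d cX dX2.
(* The lift is restricted to the preimage of [D], since the openness argument needs an injective
   differential at all points of a neighbourhood of [y0]. *)
pose A := dc_lift_domain phi c d `&` (c.1 `&` c.2 @^-1` D).
have Ao : relatively_open (@cylinder R m) A.
  by apply: relatively_openI => //; apply: dc_coord_preimage_open => //;
    exact: ccoord.
have Ay0 : A y0.
  by split; split=> //; rewrite /= y0p.
have [Vhat [psi [[V0 V0o VE] psih [psio _] dE dpsi]]] := dcoord d dX2.
have Fcyl y : A y -> cylinder (F y).
  by move=> [Ly _]; have [] := FP _ Ly; rewrite dE => -[].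
have Fdiff y : A y -> exists E : 'rV[R]_(m + 1) -> 'rV[R]_(m + 1),
    [/\ differentiable E y, (\forall x \near y, A x -> F x = E x) &
      forall v, cylinder_tangent y v -> 'd E y v = 0 -> v = 0].
  move=> [Ly [cy Dy]]; have [E Ean FE] := Fan _ Ly.
  exists E; split; first exact: analytic_differentiable.
    apply: (@filterS _ (nbhs y) (nbhs_filter y) _ _ _ FE) => x xFE [Lx _]; exact: xFE.
  exact: (lift_differential_injective _ _ _ _ _ _ _ _ _ _ cX dX2 f2an ff2 Lo FP
    Ly (Dimm _ Dy) Ean FE).
have [eta e0 capF] := cylinder_open_image Ao Fcyl Fdiff _ Ay0.
have capd z : cap eta (F y0) z -> d.1 z /\ range f (f2 (d.2 z)).
  move=> /capF[y [Ly _] <-]; have [dFy ->] := FP _ Ly; split=> //.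
  by exists (c.2 y) => //; rewrite ff2.
have Vcap z : cap eta (F y0) z -> Vhat (cone_proj z).
  by move=> /capd[+ _]; rewrite dE => -[].
have [z zcap z0] := cap_nonzero_height _ _ e0 (Fcyl _ Ay0).
exists (psi (cone_proj z)).
apply: (@filterS _ _ _ (psi @` (Vhat `&` cone_cap eta (F y0)))).
  move=> _ [q [Vq qcap] <-].
  have qc : double_cone q by move: Vq; rewrite VE => -[].
  have [z' z'cap <-] := cone_cap_onto _ _ _ qc qcap.
  have [dz' fz'] := capd _ z'cap.
  by rewrite /= -dpsi.
apply: open_nbhs_nbhs; split.
  by apply: homeomorphism_image_open => //; exact: cone_cap_open.
exists (cone_proj z) => //; split; first exact: Vcap.
exact: cap_cone_cap.
Qed.

End Extension.

Theorem proposition2p23 (R : realType) (m n : nat)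
    (hm : (2 <= m)%N) (hmn : (m <= n)%N)
    (N : analytic_manifold R n) (X : dc_manifold R m) (f : X -> N)
    (hX : connected [set: X])
    (hf : is_dc_map_to_manifold f)
    (hdim : m_dimensional f)
    (hcomplete : analytically_complete (range f)) :
  ~ admits_analytic_extension f.
Proof.
move=> [X2 [f2 [X2c f2an [phi [phidc ff2 [_ nsub]]]]]]; apply: nsub.
suff E : f2 @^-1` range f = [set: X2].
  by move=> _ [x _ <-]; have : [set: X2] x by []; rewrite -E.
apply: connected_propagation => //.
  apply: dc_map_image_interior ff2 => //.
  (* A point of [X] comes from analytic completeness, which includes that [range f] is nonempty. *)
  by have [[_ [x _ _]] _] := hcomplete; exists x.
by move=> x; have [U Ux UP] := dc_local_propagation _ f2 _ hm f2an hcomplete x;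
  exists U.
Qed.
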